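(* Let $k\ge1$ be an integer, let $\lambda_1,\dots,\lambda_k>0$ and $\mu_1,\dots,\mu_k>0$, and let $0<\alpha\le1$. Let $\{\mathcal S^\alpha(t)\}_{t\ge0}$ be the generalized fractional Skellam process with these rates. Then for every integer $r\ge1$ its $r$th factorial moment $\Psi^\alpha(r,t)=\mathbb E\left(\mathcal S^\alpha(t)(\mathcal S^\alpha(t)-1)\cdots(\mathcal S^\alpha(t)-r+1)\right)$ is given by $$\Psi^\alpha(r,t)=r!\sum_{n=1}^r\frac{t^{n\alpha}}{\Gamma(n\alpha+1)}\sum_{\substack{m_1+\dots+m_n=r\\ m_i\in\mathbb N}}\ \prod_{\ell=1}^n\left(\frac1{m_\ell!}\sum_{j=1}^k\left((j)_{m_\ell}\lambda_j+(-1)^{m_\ell}j^{(m_\ell)}\mu_j\right)\right),$$ where $(j)_m=j(j-1)\cdots(j-m+1)$ denotes the falling factorial and $j^{(m)}=j(j+1)\cdots(j+m-1)$ denotes the rising factorial.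
   Context: $\mathbb N=\{1,2,\dots\}$. The generalized counting process (GCP) with positive rates $\lambda_1,\dots,\lambda_k$ is the counting process $\{M(t)\}_{t\ge0}$ with $M(0)=0$ that performs $k$ kinds of jumps of amplitude $1,2,\dots,k$ with rates $\lambda_1,\dots,\lambda_k$, respectively; equivalently $M(t)=\sum_{j=1}^k jN_j(t)$ in law, where $N_1,\dots,N_k$ are independent Poisson processes with intensities $\lambda_1,\dots,\lambda_k$. The generalized Skellam process (GSP) is $\mathcal S(t)=M_1(t)-M_2(t)$, where $M_1$ and $M_2$ are independent GCPs with rates $\lambda_1,\dots,\lambda_k$ and $\mu_1,\dots,\mu_k$, respectively. For $0<\alpha<1$, the stable subordinator $\{D_\alpha(t)\}_{t\ge0}$ is the non-decreasing Lévy process with $\mathbb E(e^{-sD_\alpha(t)})=e^{-ts^\alpha}$, $s>0$, and the inverse stable subordinator is $Y_\alpha(t)=\inf\{x\ge0:D_\alpha(x)>t\}$. The generalized fractional Skellam process (GFSP) is $\mathcal S^\alpha(t)=\mathcal S(Y_\alpha(t))$ for $0<\alpha<1$, with $\mathcal S$ independent of $Y_\alpha$, and $\mathcal S^1(t)=\mathcal S(t)$. *)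

(* Defs.v *)
From HB Require Import structures.
From mathcomp Require Import all_boot all_order all_algebra.
From mathcomp Require Import all_classical all_reals all_analysis.
Set Implicit Arguments.
Unset Strict Implicit.
Unset Printing Implicit Defensive.
Import Order.TTheory GRing.Theory Num.Theory.
Import numFieldNormedType.Exports.
Local Open Scope classical_set_scope.
Local Open Scope ring_scope.

(* Processes indexed by [0, +oo[ are encoded as families indexed by R; every
   definition below only constrains the members with nonnegative index. *)
Definition process d (T : measurableType d) (R : realType)
  (P : probability T R) := R -> {RV P >-> R}.

Section independence.
Context d (T : measurableType d) (R : realType) (P : probability T R).
Implicit Types X Y : process P.

Definition sigma_process X : set (set T) :=
  <<s [set A | exists t : R, exists B : set R,
         [/\ 0 <= t, measurable B & A = X t @^-1` B]] >>.

Definition independent_processes X Y :=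
  forall A B, sigma_process X A -> sigma_process Y B ->
    P (A `&` B) = (P A * P B)%E.

(* The product rule for subfamilies follows by taking [A i = setT]. *)
Definition mutually_independent_processes (I : finType) (X : I -> process P) :=
  forall A : I -> set T, (forall i, sigma_process (X i) (A i)) ->
    P (\bigcap_i A i) = (\prod_(i : I) P (A i))%E.

Definition increment X (s t : R) : T -> R := fun w => X t w - X s w.

Definition independent_increments X :=
  forall (n : nat) (t : nat -> R) (B : nat -> set R),
    0 <= t 0%N -> (forall i, t i <= t i.+1) -> (forall i, measurable (B i)) ->
    P (\bigcap_(i < n) (increment X (t i) (t i.+1) @^-1` B i)) =
    (\prod_(i < n) P (increment X (t i) (t i.+1) @^-1` B i))%E.

Definition stationary_increments X :=
  forall (s t : R) (B : set R), 0 <= s -> 0 <= t -> measurable B ->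
    P (increment X s (s + t) @^-1` B) = P (increment X 0 t @^-1` B).

End independence.

(* Equality of all finite-dimensional distributions; the second family need
   not be bundled with its measurability. *)
Definition same_law d1 (T1 : measurableType d1) d2 (T2 : measurableType d2)
    (R : realType) (P1 : probability T1 R) (P2 : probability T2 R)
    (X1 : process P1) (X2 : R -> T2 -> R) :=
  forall (n : nat) (t : 'I_n -> R) (B : 'I_n -> set R),
    (forall i, 0 <= t i) -> (forall i, measurable (B i)) ->
    P1 (\bigcap_i (X1 (t i) @^-1` B i)) = P2 (\bigcap_i (X2 (t i) @^-1` B i)).

Section counting.
Context d (T : measurableType d) (R : realType) (P : probability T R).

Definition counting_process (M : process P) :=
  {ae P, forall w,
    [/\ M 0 w = 0,
        forall t, 0 <= t -> exists n : nat, M t w = n%:R,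
        forall s t, 0 <= s -> s <= t -> M s w <= M t w
      & forall t, 0 <= t -> M s w @[s --> t^'+] --> M t w]}.

Definition poisson_process (rate : R) (N : process P) :=
  [/\ counting_process N,
      independent_increments N
    & forall (s t : R) (n : nat), 0 <= s -> s < t ->
        P (increment N s t @^-1` [set n%:R]) =
        (poisson_pmf (rate * (t - s)) n)%:E].

End counting.

(* The rate of the jumps of amplitude [j.+1] is [lambda j]. The Poisson
   processes may live on another probability space, since a generalized
   counting process is only equal in law to their weighted sum. *)
Definition GCP (R : realType) (k : nat) (lambda : 'I_k -> R)
    d (T : measurableType d) (P : probability T R) (M : process P) :=
  counting_process M /\
  exists (d' : measure_display) (T' : measurableType d')
         (P' : probability T' R) (N : 'I_k -> process P'),
    [/\ forall j, poisson_process (lambda j) (N j),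
        mutually_independent_processes N
      & same_law P' M (fun t w => \sum_(j < k) j.+1%:R * N j t w)].

Definition GSP (R : realType) (k : nat) (lambda mu : 'I_k -> R)
    d (T : measurableType d) (P : probability T R) (S : process P) :=
  exists M1 M2 : process P,
    [/\ GCP lambda M1, GCP mu M2, independent_processes M1 M2
      & forall t w, 0 <= t -> S t w = M1 t w - M2 t w].

Section subordinators.
Context d (T : measurableType d) (R : realType) (P : probability T R).

Definition levy_process (D : process P) :=
  [/\ {ae P, forall w, D 0 w = 0},
      independent_increments D,
      stationary_increments D,
      (forall t e : R, 0 <= t -> 0 < e ->
        (fun s : R => P [set w | e < `|D s w - D t w|])
          @ within `[0, +oo[ (nbhs t) --> 0%E)
    & {ae P, forall w,
        (forall t, 0 <= t -> D s w @[s --> t^'+] --> D t w) /\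
        (forall t, 0 < t -> cvg (D s w @[s --> t^'-]))}].

Definition stable_subordinator (alpha : R) (D : process P) :=
  [/\ levy_process D,
      {ae P, forall w, forall s t, 0 <= s -> s <= t -> D s w <= D t w}
    & forall s t, 0 < s -> 0 <= t ->
        ('E_P[fun w => expR (- (s * D t w))%R] =
         (expR (- (t * s `^ alpha)))%:E)%E].

Definition inverse_stable_subordinator (alpha : R) (Y : process P) :=
  exists2 D : process P, stable_subordinator alpha D &
    forall t w, 0 <= t -> Y t w = inf [set x | 0 <= x /\ t < D x w].

End subordinators.

Definition GFSP (R : realType) (k : nat) (alpha : R) (lambda mu : 'I_k -> R)
    d (T : measurableType d) (P : probability T R) (X : process P) :=
  exists2 S : process P, GSP lambda mu S &
    (alpha = 1 /\ forall t w, 0 <= t -> X t w = S t w) \/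
    (0 < alpha < 1 /\
     exists Y : process P,
       [/\ inverse_stable_subordinator alpha Y, independent_processes S Y
         & forall t w, 0 <= t -> X t w = S (Y t w) w]).

(* Euler's Gamma function on ]0, +oo[. *)
Definition Gamma (R : realType) (a : R) : R :=
  \int[lebesgue_measure]_(x in `]0, +oo[) (x `^ (a - 1) * expR (- x)).

Definition rising_factorial (j m : nat) : nat := (\prod_(i < m) (j + i))%N.

Definition factorial_moment (R : realType) d (T : measurableType d)
    (P : probability T R) (X : T -> R) (r : nat) : \bar R :=
  ('E_P[fun w => (\prod_(i < r) (X w - i%:R))%R])%E.

(* Main.v *)
Require Import Defs.
From HB Require Import structures.
From mathcomp Require Import all_boot all_order all_algebra.
From mathcomp Require Import ring lra.
From mathcomp Require Import all_classical all_reals all_analysis.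
From mathcomp Require Import measurable_realfun.
Import Order.TTheory GRing.Theory Num.Theory.
Import numFieldNormedType.Exports.
Local Open Scope classical_set_scope.
Local Open Scope ring_scope.
Set Implicit Arguments.
Unset Strict Implicit.
Unset Printing Implicit Defensive.

(** At a fixed time the process [S u] is a difference of weighted sums of
    independent Poisson variables, so that formally the mean of
    [(1 + x) ^ (S u)] is [exp (u * b x)], where [b] sums [(1 + x) ^ j - 1] over the
    upward jumps and [(1 + x) ^ (- j) - 1] over the downward ones, weighted by their
    rates. The factorial moment of order [r] is [r!] times the coefficient of
    [x ^ r], a polynomial in [u] whose coefficients are the sums over compositions of
    the statement. The formal computation is made rigorous coefficientwise, with
    power series truncated at degree [r]: expanding around [1] only involves the
    factorial moments of Poisson variables and products of independent nonnegative
    variables ([GCP_coef], [GSP_factorial_moment]).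

    The time change replaces [u ^ n] by the [n]th moment of [Y t], and it remains to
    see that this is [n! * t ^ (n * alpha) / Gamma (n * alpha + 1)]
    ([inverse_stable_moment]). The event [Y t > x] is, up to its boundary, [D x <= t],
    so the moment is the integral of [P (D x <= t)] against [n * x ^ (n - 1)]. If the
    indicator of [D x <= t] were a polynomial [Q] in [exp (- D x)] without constant
    term, the Laplace transform of [D x] would give the integral as a sum of
    [Q_k * n! * k ^ (- n * alpha)]. The same sum, up to a constant, arises from the
    deterministic motion [y |-> y] and the density of [y ^ (n * alpha)], where the
    integral is explicit. Bernstein polynomials, with an error proportional to the
    variable so that it remains integrable, replace the indicator
    ([polynomial_step], [tail_integral_le], [tail_integral_ge]); this is a Laplace
    inversion that needs no uniqueness theorem.

    Finally the mean of [f (S (Y t))] is the mean of [G (Y t)], where [G u] is the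
    mean of [f (S u)] ([compose_moment]). For nonnegative [f] an inequality follows
    from right continuity and Fatou's lemma, by discretizing [Y t] from above;
    perturbing [f] by a small multiple of [f ^ 2] turns it into an equality. *)

(** * Truncated power series *)

Section truncated_series.
Variable R : comNzRingType.
Implicit Types (p q : {poly R}) (r n i : nat).

(** Power series are handled as polynomials modulo the monomials of degree
    larger than [r], which keeps every sum finite. *)
Definition eq_upto r p q := forall i, (i <= r)%N -> p`_i = q`_i.

Lemma eq_uptoM r p p' q q' :
  eq_upto r p p' -> eq_upto r q q' -> eq_upto r (p * q) (p' * q').
Proof.
move=> pp qq i ir; rewrite !coefM; apply: eq_bigr => j _.
rewrite pp ?qq//; first by rewrite (leq_trans _ ir)// leq_subr.
by rewrite (leq_trans _ ir)// -ltnS.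
Qed.

Lemma eq_upto_prod r (I : Type) (s : seq I) (p q : I -> {poly R}) :
  (forall l, eq_upto r (p l) (q l)) ->
  eq_upto r (\prod_(l <- s) p l) (\prod_(l <- s) q l).
Proof.
move=> pq; elim: s => [|l s IH]; first by rewrite !big_nil.
by rewrite !big_cons; apply: eq_uptoM.
Qed.

Lemma coef_prod_ffun r n (p : 'I_n -> {poly R}) i : (i <= r)%N ->
  (\prod_(l < n) p l)`_i =
  \sum_(m : {ffun 'I_n -> 'I_r.+1} | (\sum_(l < n) m l == i)%N)
     \prod_(l < n) (p l)`_(m l).
Proof.
move=> ir.
have trunc l : eq_upto r (p l) (\sum_(j < r.+1) (p l)`_j *: 'X^j).
  by move=> j jr; rewrite -(poly_def r.+1 (fun j => (p l)`_j)) coef_poly ltnS jr.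
rewrite (eq_upto_prod _ trunc ir) bigA_distr_bigA /= coef_sum.
rewrite [RHS]big_mkcond/=; apply: eq_bigr => m _.
rewrite scaler_prod coefZ prodrXr coefXn eq_sym; case: eqP => _; rewrite ?mulr1 ?mulr0//.
Qed.

Lemma coef0_expr (p : {poly R}) m : (p ^+ m)`_0 = p`_0 ^+ m.
Proof. by rewrite -!horner_coef0 horner_exp. Qed.

Lemma coef_expr_lt (p : {poly R}) m i : p`_0 = 0 -> (i < m)%N -> (p ^+ m)`_i = 0.
Proof.
move=> p0; elim: m i => // m IH i im.
rewrite exprS coefM big1// => -[[|j] /= ji] _; first by rewrite p0 mul0r.
rewrite IH ?mulr0//; move: im ji; rewrite !ltnS; case: i => // i im _.
by rewrite subSS (leq_ltn_trans (leq_subr _ _)).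
Qed.

(** The binomial series of [1 + p]: since [p] has no constant term, the powers
    beyond [r] do not reach degree [i], and the summation bound can be [r]
    instead of the random exponent [N]. This makes the coefficient a fixed linear
    combination of the binomial coefficients of [N]. *)
Lemma coef_expr1D (p : {poly R}) N r i : p`_0 = 0 -> (i <= r)%N ->
  ((1 + p) ^+ N)`_i = \sum_(m < r.+1) 'C(N, m)%:R * (p ^+ m)`_i.
Proof.
move=> p0 ir.
rewrite exprDn coef_sum.
under eq_bigr do rewrite expr1n mul1r coefMn -mulr_natl.
pose F m : R := 'C(N, m)%:R * (p ^+ m)`_i.
rewrite -!(big_mkord xpredT F).
have [Nr|rN] := leqP N r.
  rewrite [RHS](big_cat_nat _ (n := N.+1))//= [X in _ + X]big_nat_cond.
  by rewrite [X in _ + X]big1 ?addr0// => m /andP[/andP[Nm _] _]; rewrite /F bin_small// mul0r.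
rewrite (big_cat_nat _ (n := r.+1))//=; last by rewrite ltnS ltnW.
rewrite [X in _ + X]big_nat_cond [X in _ + X]big1 ?addr0// => m /andP[/andP[rm _] _].
by rewrite /F coef_expr_lt ?mulr0// (leq_ltn_trans ir).
Qed.

End truncated_series.

Section exp_trunc.
Variable R : numFieldType.
Implicit Types (a b : {poly R}) (r n i : nat).

Definition exp_trunc r a := \sum_(m < r.+1) (m`!%:R)^-1 *: a ^+ m.

Lemma coef_exp_trunc r a i :
  (exp_trunc r a)`_i = \sum_(m < r.+1) (m`!%:R)^-1 * (a ^+ m)`_i.
Proof. by rewrite coef_sum; apply: eq_bigr => m _; rewrite coefZ. Qed.

Lemma sum_triangle (V : nmodType) n (F : nat -> nat -> V) :
  \sum_(0 <= N < n) \sum_(0 <= j < N.+1) F (N - j)%N j =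
  \sum_(0 <= j < n) \sum_(0 <= m < n - j) F m j.
Proof.
transitivity (\sum_(0 <= N < n) \sum_(0 <= j < n | (j <= N)%N) F (N - j)%N j).
  apply: eq_big_nat => N /= Nn.
  rewrite [RHS](big_cat_nat _ (n := N.+1))//= [X in _ + X]big_nat_cond.
  rewrite [X in _ + X]big1 ?addr0 => [|j /andP[/andP[]]]; last by rewrite ltnNge => /negbTE->.
  rewrite [RHS]big_nat_cond [LHS]big_nat_cond.
  by apply: eq_bigl => j; rewrite ltnS andbT; case: (j <= N)%N; rewrite ?andbF.
transitivity (\sum_(0 <= j < n) \sum_(0 <= N < n | (j <= N)%N) F (N - j)%N j).
  rewrite !big_mkord.
  under eq_bigr do rewrite big_mkord.
  under [RHS]eq_bigr do rewrite big_mkord.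
  exact: exchange_big_dep.
apply: eq_big_nat => j /= jn.
rewrite (big_cat_nat _ (n := j))//=; last exact: ltnW.
rewrite big_nat_cond big1 ?add0r => [|N /andP[/andP[_]]]; last by rewrite ltnNge => /negbTE->.
rewrite -{1}[j]add0n big_addn.
rewrite big_nat_cond [RHS]big_nat_cond.
apply: eq_big => [m|m _]; last by rewrite addnK.
by rewrite leq_addl andbT.
Qed.

(** The product of the two truncated exponentials has the extra terms
    [a ^+ m * b ^+ j] with [m + j > r]; these are divisible by a power of the
    indeterminate larger than [r]. *)
Lemma exp_truncD r a b : a`_0 = 0 -> b`_0 = 0 ->
  eq_upto r (exp_trunc r (a + b)) (exp_trunc r a * exp_trunc r b).
Proof.
move=> a0 b0 i ir.
pose F m j := (((m`!%:R)^-1 *: a ^+ m) * ((j`!%:R)^-1 *: b ^+ j))`_i.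
have F0 m j : (r < m + j)%N -> F m j = 0.
  move=> rmj; rewrite /F -scalerAl -scalerAr !coefZ coefM big1 ?mulr0// => l _.
  have [lm|ml] := ltnP l m; first by rewrite coef_expr_lt// mul0r.
  rewrite [X in _ * X]coef_expr_lt ?mulr0//.
  have li : (l <= i)%N by rewrite -ltnS.
  rewrite ltn_subLR// (leq_ltn_trans ir)// (leq_trans rmj)// leq_add2r//.
transitivity (\sum_(0 <= N < r.+1) \sum_(0 <= j < N.+1) F (N - j)%N j).
  rewrite coef_exp_trunc big_mkord; apply: eq_bigr => N _.
  rewrite exprDn coef_sum mulr_sumr big_mkord; apply: eq_bigr => j _.
  rewrite /F -scalerAl -scalerAr !coefZ coefMn -(mulr_natl _ 'C(N, j)).
  rewrite [LHS]mulrA [RHS]mulrA; congr (_ * _).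
  have jN : (j <= N)%N by rewrite -ltnS.
  have f0 k : (k`!%:R : R) != 0 by rewrite pnatr_eq0 -lt0n fact_gt0.
  rewrite -(bin_fact jN) !natrM.
  have c0 : ('C(N, j)%:R : R) != 0 by rewrite pnatr_eq0 -lt0n bin_gt0.
  by rewrite [LHS]mulrC invfM (mulrA _ _^-1) divff// mul1r invfM mulrC.
rewrite sum_triangle mulr_sumr coef_sum big_mkord; apply: eq_bigr => j _.
rewrite mulr_suml coef_sum -(big_mkord xpredT (fun m => F m j)).
rewrite [RHS](big_cat_nat _ (n := (r.+1 - j)%N))//= ?leq_subr//.
rewrite [X in _ + X]big_nat_cond [X in _ + X]big1 ?addr0// => m /andP[/andP[rm _] _].
by apply: F0; rewrite addnC -leq_subLR.
Qed.

Lemma exp_trunc0 r : exp_trunc r 0 = 1.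
Proof.
rewrite /exp_trunc big_ord_recl expr0 fact0 invr1 scale1r big1 ?addr0// => i _.
by rewrite expr0n scaler0.
Qed.

Lemma exp_trunc_sum r (I : Type) (s : seq I) (a : I -> {poly R}) :
  (forall l, (a l)`_0 = 0) ->
  eq_upto r (exp_trunc r (\sum_(l <- s) a l)) (\prod_(l <- s) exp_trunc r (a l)).
Proof.
move=> a0; elim: s => [|l s IH]; first by rewrite !big_nil exp_trunc0.
rewrite !big_cons => i ir; rewrite exp_truncD//; last first.
  by rewrite coef_sum big1.
by apply: (@eq_uptoM _ r).
Qed.

(** Without constant terms only the compositions of [r] into positive parts
    contribute; this is where the inner sum of the final formula comes from. *)
Lemma coef_prod_pos n r (p : 'I_n -> {poly R}) :
  (forall l, (p l)`_0 = 0) ->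
  (\prod_(l < n) p l)`_r =
  \sum_(m : {ffun 'I_n -> 'I_r.+1} |
      (\sum_(l < n) m l == r)%N && [forall l, (0 < m l)%N])
     \prod_(l < n) (p l)`_(m l).
Proof.
move=> p0; rewrite (@coef_prod_ffun _ r)//.
rewrite (bigID (fun m : {ffun 'I_n -> 'I_r.+1} => [forall l, (0 < m l)%N]))/=.
rewrite [X in _ + X]big1 ?addr0// => m /andP[_ /forallPn[l]].
by rewrite -eqn0Ngt => /eqP ml; rewrite (bigD1 l)//= ml p0 mul0r.
Qed.

Definition geom_trunc r : {poly R} := \poly_(i < r.+1) 1.

(** [(1 + X + X^2 + ...) ^ M] is the generating function of the rising
    factorials of [M] divided by factorials, by the Pascal-like recurrence that
    multiplication by [1 - X] expresses. *)
Lemma coef_geomX r M i : (i <= r)%N ->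
  i`!%:R * (geom_trunc r ^+ M)`_i = (rising_factorial M i)%:R.
Proof.
elim: M i => [|M IHM] i.
  rewrite expr0 coef1; case: i => [|i] _; first by rewrite /rising_factorial big_ord0 mulr1.
  by rewrite /= mulr0 /rising_factorial big_ord_recl /= mul0n.
elim: i => [|i IHi] ir.
  rewrite /rising_factorial big_ord0 fact0 mul1r coef0_expr /geom_trunc.
  by rewrite coef_poly /= expr1n.
have step : (geom_trunc r ^+ M.+1)`_i.+1 =
    (geom_trunc r ^+ M)`_i.+1 + (geom_trunc r ^+ M.+1)`_i.
  rewrite exprSr !coefM.
  rewrite big_ord_recr /= subnn addrC; congr (_ + _).
    by rewrite coef_poly /= mulr1.
  apply: eq_bigr => -[j /= ji] _; congr (_ * _).
  by rewrite !coef_poly !ltnS (leq_trans (leq_subr _ _) ir)// (leq_trans (leq_subr _ _) (ltnW ir)).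
rewrite step mulrDr IHM// factS natrM -mulrA (IHi (ltnW ir)).
rewrite -natrM -natrD; congr _%:R.
rewrite /rising_factorial big_ord_recl [in RHS]big_ord_recr /= addn0.
under eq_bigr do rewrite /bump /= add1n addnS -addSn.
by rewrite -mulnDl mulnC; congr (_ * _)%N; rewrite addnS addSn.
Qed.

Lemma coef_X1X M i : (('X + 1 : {poly R}) ^+ M)`_i = 'C(M, i)%:R.
Proof.
rewrite addrC exprDn coef_sum.
under eq_bigr do rewrite expr1n mul1r coefMn coefXn.
have [Mi|iM] := ltnP M i.
  rewrite bin_small// big1// => j _.
  by rewrite gtn_eqF ?mul0rn// (leq_ltn_trans _ Mi)// -ltnS.
rewrite (bigD1 (Ordinal (iM : (i < M.+1)%N)))//= eqxx big1 ?addr0// => j.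
by rewrite -val_eqE /= eq_sym => /negbTE ->; rewrite mul0rn.
Qed.

Definition falling (x : R) n := \prod_(i < n) (x - i%:R).

Lemma fallingS x n : falling x n.+1 = falling x n * (x - n%:R).
Proof. by rewrite /falling big_ord_recr. Qed.

Lemma falling_nat (m n : nat) : falling m%:R n = (m ^_ n)%:R.
Proof.
elim: n => [|n IH]; first by rewrite /falling big_ord0.
rewrite fallingS IH ffactnSr natrM.
have [nm|mn] := leqP n m; first by rewrite natrB.
by rewrite ffact_small// !mul0r.
Qed.

Lemma falling_natN (m n : nat) :
  falling (- m%:R) n = (-1) ^+ n * (rising_factorial m n)%:R.
Proof.
rewrite /falling /rising_factorial natr_prod -[in (-1) ^+ n](card_ord n) -prodr_const -big_split.
by apply: eq_bigr => i _ /=; rewrite natrD; ring.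
Qed.

(** Chu-Vandermonde convolution, by the Pascal recurrence on [r]. *)
Lemma fallingD (x y : R) r :
  falling (x + y) r = \sum_(i < r.+1) 'C(r, i)%:R * falling x i * falling y (r - i).
Proof.
elim: r => [|r IH].
  by rewrite big_ord_recl big_ord0 /falling !big_ord0 bin0 !mulr1 addr0.
rewrite fallingS IH mulr_suml.
transitivity (\sum_(i < r.+1) ('C(r, i)%:R * falling x i.+1 * falling y (r - i) +
    'C(r, i)%:R * falling x i * falling y (r.+1 - i))).
  apply: eq_bigr => -[i /= ir] _; rewrite subSn// !fallingS natrB//; ring.
rewrite big_split/=.
pose G i := falling x i * falling y (r.+1 - i).
transitivity (\sum_(i < r.+1) 'C(r, i)%:R * G i.+1 + \sum_(i < r.+2) 'C(r, i)%:R * G i).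
  congr (_ + _); first by apply: eq_bigr => i _; rewrite /G subSS mulrA.
  rewrite [RHS]big_ord_recr /= bin_small// mul0r addr0.
  by apply: eq_bigr => i _; rewrite /G mulrA.
rewrite addrC big_ord_recl [RHS]big_ord_recl /= !bin0 /G !mulrA -addrA; congr (_ + _).
rewrite -big_split /=; apply: eq_bigr => i _.
by rewrite /bump /= add1n binS natrD -!mulrA -mulrDl.
Qed.

End exp_trunc.

(** * The power density and the Gamma function *)

Section power_density_theory.
Context {R : realType}.
Local Notation mu := (@lebesgue_measure R).
Implicit Types (q x y c : R).

(** The density of the measure whose cumulative function is [x |-> x ^ q]. Moments
    of order [q] are integrals of tails against it, and its Laplace transform is
    [Gamma (q + 1) * c ^ (- q)]; both facts hold for every real [q > 0]. *)
Definition power_density q x : R := q * x `^ (q - 1).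

Lemma power_density_ge0 q x : 0 < q -> 0 <= power_density q x.
Proof. by move=> q0; rewrite mulr_ge0 ?powR_ge0// ltW. Qed.

Lemma measurable_power_density q (D : set R) : measurable_fun D (power_density q).
Proof.
apply: measurable_funTS; exact: measurable_funM.
Qed.

Lemma measurable_power_densityE q (D : set R) : measurable_fun D (EFin \o power_density q).
Proof. by apply/measurable_EFinP; exact: measurable_power_density. Qed.

Lemma continuous_powRl q y : 0 < y -> {for y, continuous (fun x => x `^ q)}.
Proof.
move=> y0; apply/differentiable_continuous/derivable1_diffP.
by apply: derivable_powR; rewrite in_itv/= y0.
Qed.

Lemma integral_power_density_itvcc q x y : 0 < q -> 0 < x -> x < y ->
  (\int[mu]_(z in `[x, y]) (power_density q z)%:E = (y `^ q - x `^ q)%:E)%E.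
Proof.
move=> q0 x0 xy; rewrite EFinB.
have cp p z : x <= z -> {for z, continuous (fun z => z `^ p)}.
  by move=> xz; apply: continuous_powRl; exact: lt_le_trans xz.
apply: (@continuous_FTC2 _ (power_density q) (fun z => z `^ q)) => //.
- apply: continuous_in_subspaceT => z; rewrite inE/= in_itv/= => /andP[xz _].
  by rewrite /continuous_at; apply: cvgM; [exact: cvg_cst|exact: cp].
- split.
  + move=> z; rewrite in_itv/= => /andP[xz _].
    by apply: derivable_powR; rewrite in_itv/= andbT (lt_trans x0).
  + by apply/cvg_at_right_filter/cp.
  + by apply/cvg_at_left_filter/cp/ltW.
- move=> z; rewrite in_itv/= => /andP[xz _].
  by rewrite powR_derive1// in_itv/= andbT (lt_trans x0).
Qed.

Lemma integral_power_density q y b : 0 < q -> 0 <= y ->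
  (\int[mu]_(z in [set` Interval (BRight 0%R) (BSide b y)]) (power_density q z)%:E = (y `^ q)%:E)%E.
Proof.
move=> q0; rewrite le_eqVlt => /predU1P[<-|y0].
  rewrite powR0 ?gt_eqF//.
  have -> : [set` Interval (BRight 0) (BSide b 0)] = set0 :> set R.
    apply/seteqP; split => // z; rewrite /= in_itv/= => /andP[z0].
    case: b => /= z1; first by have := lt_trans z0 z1; rewrite ltxx.
    by have := lt_le_trans z0 z1; rewrite ltxx.
  by rewrite integral_set0.
have mk (D : set R) : measurable_fun D (EFin \o power_density q).
  exact: measurable_power_densityE.
rewrite integral_itv_bndoo; last exact: mk.
rewrite -(@integral_itv_bndoo _ 0 y _ false false); last exact: mk.
pose F n : set R := [set` `[y / n.+2%:R, y]].
(* For q < 1 the density blows up at 0, so the fundamental theorem of calculus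
   is applied on [y / (n + 2), y] and n tends to infinity. *)
have F_up : \bigcup_n F n = [set` `]0, y]].
  apply/seteqP; split => [z [n _]|z]; rewrite /F/= !in_itv/=.
    by move=> /andP[nz ->]; rewrite andbT (lt_le_trans _ nz)// divr_gt0.
  move=> /andP[z0 zy]; exists (Num.truncn (y / z)) => //.
  rewrite /= in_itv/= zy andbT ler_pdivrMr// mulrC -ler_pdivrMr//.
  by rewrite (le_trans (ltW (truncnS_gt _)))// ler_nat.
have F_mono : nondecreasing_seq F.
  move=> m n mn; apply/subsetPset => z; rewrite /F/= !in_itv/= => /andP[mz ->].
  by rewrite andbT (le_trans _ mz)// ler_pM2l// lef_pV2 ?posrE// ler_nat !ltnS.
have cF := @ge0_nondecreasing_set_cvg_integral _ (measurableTypeR R) R F (EFin \o power_density q) lebesgue_measure F_mono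
  (fun _ => measurable_itv _) (fun _ => mk _) (fun _ _ _ => power_density_ge0 _ q0).
rewrite F_up in cF.
rewrite -(cvg_lim _ cF)//.
have Fn n : (\int[mu]_(x in F n) (EFin \o power_density q) x = (y `^ q - (y / n.+2%:R) `^ q)%:E)%E.
  by rewrite /F/= integral_power_density_itvcc// ?divr_gt0// ltr_pdivrMr// ltr_pMr// ltr1n.
under eq_fun do rewrite Fn.
apply/cvg_lim => //; apply/cvg_EFin; first exact: nearW.
rewrite -[X in _ --> X]subr0; apply: cvgB; first exact: cvg_cst.
have /cvg_at_rightP cp := powR_cvg0 q0.
apply: (cp (fun n : nat => y / n.+2%:R)); split.
  by move=> n; rewrite divr_gt0.
rewrite -[X in _ --> X](mulr0 y); apply: cvgM; first exact: cvg_cst.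
have := @cvg_harmonic R; rewrite -(cvg_shiftS (@harmonic R)); exact.
Qed.

Lemma integral_expR_tail c x : 0 < c ->
  (\int[mu]_(y in `[x, +oo[) (c * expR (- (c * y)))%:E = (expR (- (c * x)))%:E)%E.
Proof.
move=> c0.
have dF y : is_derive y 1 (fun y : R => - expR (- (c * y))) (c * expR (- (c * y))).
  apply: is_derive_eq; rewrite /GRing.scale/=; ring.
have cd : continuous (fun y : R => - expR (- (c * y))).
  by move=> y; apply: differentiable_continuous; apply/derivable1_diffP.
have cd2 : continuous (fun y : R => c * expR (- (c * y))).
  move=> y; apply: differentiable_continuous; apply/derivable1_diffP; exact: ex_derive.
rewrite (@ge0_continuous_FTC2y _ _ (fun y => - expR (- (c * y))) _ 0).
- by rewrite sub0e EFinN oppeK.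
- by move=> y _; rewrite mulr_ge0 ?expR_ge0// ltW.
- exact: continuous_subspaceT.
- rewrite -oppr0; apply: cvgN.
  apply: (@cvg_comp _ _ _ (fun y => c * y) (fun z => expR (- z)) _ (pinfty_nbhs R)); last exact: cvgr_expR.
  exact: gt0_cvgMry.
- by move=> y _; exact: ex_derive.
- by apply/cvg_at_right_filter; exact: cd.
- by move=> y _; rewrite derive1E; exact: derive_val.
Qed.

Lemma within_continuous_powR_expR q : 0 < q ->
  {within `[0, +oo[, continuous (fun x => x `^ q * expR (- x))}.
Proof.
move=> q0; apply/continuous_within_itvcyP.
have ce : continuous (fun y : R => expR (- y)).
  move=> y; apply: differentiable_continuous; apply/derivable1_diffP; exact: ex_derive.
split.
  move=> y; rewrite in_itv/= andbT => y0.
  by rewrite /continuous_at; apply: cvgM; [exact: continuous_powRl|exact: ce].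
apply: cvgM; last by apply/cvg_at_right_filter; exact: ce.
rewrite powR0 ?gt_eqF//; exact: powR_cvg0.
Qed.

Lemma integral_powR_expR_scale q c : 0 < q -> 0 < c ->
  (\int[mu]_(x in `[0%R, +oo[) (x `^ q * expR (- x))%:E =
   \int[mu]_(x in `[0%R, +oo[) (c `^ q * (c * expR (- (c * x)) * x `^ q))%:E)%E.
Proof.
move=> q0 c0.
have := @increasing_ge0_integration_by_substitutiony R (fun x => c * x) (fun x => x `^ q * expR (- x)) 0.
have dF : (fun x => c * x)^`()%classic = cst c.
  by apply/funext => x; rewrite derive1Ml// derive1_id mulr1.
rewrite mulr0 dF => ->.
- apply: eq_integral => x; rewrite inE/= in_itv/= andbT => x0; congr EFin.
  change ((c * x) `^ q * expR (- (c * x)) * c = c `^ q * (c * expR (- (c * x)) * x `^ q)).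
  by rewrite (powRM _ (ltW c0) x0); ring.
- by move=> x y _ _; rewrite ltr_pM2l.
- by move=> x _; exact: cst_continuous.
- exact: is_cvg_cst.
- exact: is_cvg_cst.
- split.
    by move=> x _; exact: ex_derive.
  by apply/cvg_at_right_filter; apply: mulrl_continuous.
- exact: gt0_cvgMry.
- exact: within_continuous_powR_expR.
- by move=> x _; rewrite mulr_ge0 ?powR_ge0 ?expR_ge0.
Qed.

Definition Gamma_int q : \bar R := (\int[mu]_(x in `]0%R, +oo[) (x `^ q * expR (- x))%:E)%E.

Lemma Gamma_intE q : fine (Gamma_int q) = Gamma (q + 1).
Proof. by rewrite /Gamma /Rintegral addrK. Qed.

(** Strict and weak tails are treated at once; they give the same integral,
    and both are needed because the first passage time of a level is only
    sandwiched between the two. *)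
Definition above (b : bool) x y := if b then x < y else x <= y.

Lemma measurable_natbool d (T : measurableType d) (D : set T) (h : T -> bool) :
  measurable_fun D h -> measurable_fun D (fun w => (h w)%:R : R).
Proof. by move=> mh; apply: (measurableT_comp (f := fun c : bool => c%:R : R)). Qed.

Lemma measurable_above b d (T : measurableType d) (D : set T) (f g : T -> R) :
  measurable_fun D f -> measurable_fun D g ->
  measurable_fun D (fun w => above b (f w) (g w)).
Proof. by case: b => mf mg; [exact: measurable_fun_ltr|exact: measurable_fun_ler]. Qed.

(** Tonelli's theorem applied to the weight [g w] restricted to the pairs
    [(w, x)] with [0 < x] below [Y w]. *)
Lemma layer_cake d (T : measurableType d) (m : {sigma_finite_measure set T -> \bar R})
    (g Y : T -> R) b q : 0 < q ->
  measurable_fun setT g -> measurable_fun setT Y ->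
  (forall w, 0 <= g w) -> (forall w, 0 <= Y w) ->
  (\int[m]_w (g w * Y w `^ q)%:E =
   \int[mu]_(x in `]0%R, +oo[)
      ((power_density q x)%:E * \int[m]_w (g w * (above b x (Y w))%:R)%:E))%E.
Proof.
move=> q0 mg mY g0 Y0.
pose f (p : T * measurableTypeR R) : \bar R :=
  (g p.1 * ((0 < p.2) && above b p.2 (Y p.1))%:R * power_density q p.2)%:E.
have mf : measurable_fun setT f.
  apply/measurable_EFinP; apply: measurable_funM; last first.
    by apply: measurableT_comp => //; exact: measurable_power_density.
  apply: measurable_funM; first exact: measurableT_comp.
  apply: measurable_natbool; apply: measurable_and.
    exact: measurable_fun_ltr.
  by apply: measurable_above => //; exact: measurableT_comp.
have f0 p : (0 <= f p)%E by rewrite lee_fin mulr_ge0// ?power_density_ge0// mulr_ge0.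
transitivity (\int[m]_w \int[mu]_x f (w, x))%E.
  apply: eq_integral => w _; rewrite /f/=.
  rewrite EFinM -(integral_power_density b q0 (Y0 w)) -ge0_integralZl//; last 3 first.
  - exact: measurable_power_densityE.
  - by move=> x _; rewrite lee_fin power_density_ge0.
  - by rewrite lee_fin.
  rewrite integral_mkcond; apply: eq_integral => x _.
  rewrite patchE -EFinM.
  have -> : (x \in [set` Interval (BRight 0) (BSide b (Y w))]) =
      (0 < x) && above b x (Y w).
    by rewrite /above; case: (b); apply/idP/idP; rewrite inE/= in_itv.
  by case: (_ && _); rewrite ?mulr1// mulr0 mul0r.
rewrite (fubini_tonelli f)//.
rewrite [RHS]integral_mkcond; apply: eq_integral => x _; rewrite patchE.
have -> : (x \in `]0%R, +oo[%classic) = (0 < x).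
  by apply/idP/idP; rewrite inE/= in_itv/= andbT.
case: ifPn => x0; last first.
  by apply: integral0_eq => w _; rewrite /f/= (negbTE x0) /= mulr0 mul0r.
rewrite -ge0_integralZl//; last 3 first.
- apply/measurable_EFinP; apply: measurable_funM => //.
  by apply: measurable_natbool; apply: measurable_above.
- by move=> w _; rewrite lee_fin mulr_ge0.
- by rewrite lee_fin power_density_ge0.
by apply: eq_integral => w _; rewrite /f/= x0 -EFinM mulrC.
Qed.

(** Layer cake for the measure [c * exp (- c y) dy], whose tail at [x] is
    [exp (- c x)], followed by the substitution [y |-> c y]. *)
Lemma integral_power_density_expR_Gamma_int q c : 0 < q -> 0 < c ->
  (\int[mu]_(x in `]0%R, +oo[) (power_density q x * expR (- (c * x)))%:E =
   (c `^ (- q))%:E * Gamma_int q)%E.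
Proof.
move=> q0 c0.
pose g (y : R) : R := (0 < y)%R%:R * (c * expR (- (c * y))).
have mg : measurable_fun setT g.
  apply: measurable_funM; first by apply: measurable_natbool; exact: measurable_fun_ltr.
  apply: measurable_funM => //; apply: measurableT_comp => //.
  by apply: measurableT_comp => //; exact: measurable_funM.
have g0 y : 0 <= g y by rewrite !mulr_ge0 ?expR_ge0// ltW.
have mY : measurable_fun setT (fun y : R => Num.max y 0) by exact: measurable_maxr.
have Y0 y : 0 <= Num.max y 0 :> R by rewrite le_max lexx orbT.
have := @layer_cake _ (measurableTypeR R) mu g (fun y => Num.max y 0) true q q0 mg mY g0 Y0.
have <- : (\int[mu]_(x in `]0%R, +oo[) (power_density q x * expR (- (c * x)))%:E =
  \int[mu]_(x in `]0%R, +oo[)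
     ((power_density q x)%:E * \int[mu]_w (g w * (above true x (Num.max w 0))%:R)%:E))%E.
  apply: eq_integral => x; rewrite inE/= in_itv/= andbT => x0.
  rewrite EFinM -integral_expR_tail//; congr (_ * _)%E.
  rewrite -integral_itv_obnd_cbnd; last first.
    apply/measurable_EFinP; apply: measurable_funTS; apply: measurable_funM => //.
    by apply: measurableT_comp => //; apply: measurableT_comp => //; exact: measurable_funM.
  rewrite integral_mkcond; apply: eq_integral => y _; rewrite patchE.
  have -> : (y \in `]x, +oo[%classic) = (x < y).
    by apply/idP/idP; rewrite inE/= in_itv/= andbT.
  rewrite /g /= lt_max [x < 0]ltNge (ltW x0) orbF.
  by case: ifPn => [xy|_]; rewrite ?mulr0// mulr1 (lt_trans x0 xy) mul1r.
move=> <-.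
rewrite /Gamma_int !integral_itv_obnd_cbnd; last first.
  apply/measurable_EFinP; apply: measurable_funTS; apply: measurable_funM => //; exact: measurableT_comp.
rewrite (integral_powR_expR_scale q0 c0).
under [in RHS]eq_integral do rewrite EFinM.
rewrite ge0_integralZl//; last 3 first.
- apply/measurable_EFinP; apply: measurable_funTS; apply: measurable_funM => //.
  apply: measurable_funM => //.
  by apply: measurableT_comp => //; apply: measurableT_comp => //; exact: measurable_funM.
- move=> x; rewrite /= in_itv/= andbT => x0.
  by rewrite lee_fin !mulr_ge0 ?expR_ge0 ?powR_ge0// ltW.
- by rewrite lee_fin powR_ge0.
rewrite muleA -EFinM powRN mulVf ?gt_eqF ?powR_gt0// mul1e.
rewrite [RHS]integral_mkcond; apply: eq_integral => y _; rewrite patchE.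
have -> : (y \in `[0%R, +oo[%classic) = (0 <= y).
  by apply/idP/idP; rewrite inE/= in_itv/= andbT.
rewrite /g; case: ltgtP => [y0|y0|<-].
- by rewrite mul1r.
- by rewrite !mul0r.
- by rewrite powR0 ?gt_eqF// !mulr0.
Qed.

Lemma measurable_powR_expR q (D : set R) :
  measurable_fun D (fun x : R => (x `^ q * expR (- x))%:E).
Proof.
apply/measurable_EFinP; apply: measurable_funTS; apply: measurable_funM => //.
exact: measurableT_comp.
Qed.

(** The Laplace transform of the power density at [1] gives
    [Gamma (q + 1) = q * Gamma q], hence the factorials. *)
Lemma Gamma_int_nat n : Gamma_int n%:R = (n`!%:R)%:E.
Proof.
elim: n => [|n IH].
  have := @integral_expR_tail 1 0 ltr01.
  rewrite mulr0 oppr0 expR0 fact0 => <-.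
  rewrite /Gamma_int integral_itv_obnd_cbnd; last exact: measurable_powR_expR.
  by apply: eq_integral => x _; rewrite powRr0 !mul1r.
have n0 : 0 < n.+1%:R :> R by [].
have := integral_power_density_expR_Gamma_int n0 ltr01.
rewrite powR1 mul1e => <-.
rewrite factS natrM EFinM -IH -ge0_integralZl//; last 2 first.
- exact: measurable_powR_expR.
- by move=> x _; rewrite lee_fin mulr_ge0 ?powR_ge0 ?expR_ge0.
apply: eq_integral => x _; rewrite /power_density -EFinM mul1r mulrA.
by rewrite -[in n.+1%:R - 1]addn1 natrD addrK.
Qed.

Lemma Gamma_int_ge0 q : (0 <= Gamma_int q)%E.
Proof.
by apply: integral_ge0 => x _; rewrite lee_fin mulr_ge0 ?powR_ge0 ?expR_ge0.
Qed.

Lemma Gamma_int_lty q : 0 < q -> (Gamma_int q < +oo)%E.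
Proof.
move=> q0; pose n := (Num.truncn q).+1.
have qn : q <= n%:R by rewrite ltW// truncnS_gt.
apply: (@le_lt_trans _ _ (Gamma_int 0%:R + Gamma_int n%:R)%E); last first.
  by rewrite !Gamma_int_nat -EFinD ltry.
have ge0 p x : (0 <= (x `^ p * expR (- x))%:E)%E.
  by rewrite lee_fin mulr_ge0 ?powR_ge0 ?expR_ge0.
rewrite /Gamma_int -ge0_integralD//; last 2 first.
- exact: measurable_powR_expR.
- exact: measurable_powR_expR.
apply: ge0_le_integral => //.
- exact: measurable_powR_expR.
- by apply: emeasurable_funD; exact: measurable_powR_expR.
move=> x; rewrite /= in_itv/= andbT => x0.
rewrite -EFinD lee_fin -mulrDl ler_wpM2r ?expR_ge0// powRr0.
(* x^q <= 1 + x^n for any integer n >= q *)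
have [x1|x1] := leP x 1.
  rewrite (@le_trans _ _ 1)// ?lerDl ?powR_ge0//.
  have := @ge0_ler_powR R q (ltW q0) x 1; rewrite powR1; apply => //.
  - by rewrite nnegrE ltW.
  - by rewrite nnegrE.
by rewrite (@le_trans _ _ (x `^ n%:R)) ?lerDr// ler_powR// ltW.
Qed.

Lemma Gamma_gt0 q : 0 < q -> 0 < Gamma (q + 1).
Proof.
move=> q0; rewrite -Gamma_intE fine_gt0// Gamma_int_lty// andbT.
have := integral_power_density_expR_Gamma_int q0 ltr01; rewrite powR1 mul1e => <-.
have mk (D : set R) : measurable_fun D (fun x : R => (power_density q x * expR (- (1 * x)))%:E).
  apply/measurable_EFinP; apply: measurable_funM; first exact: measurable_power_density.
  by apply: measurableT_comp => //; apply: measurableT_comp => //; exact: measurable_funM.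
apply: (@lt_le_trans _ _ (\int[mu]_(x in [set` Interval (BRight 0%R) (BSide false 1%R)])
   ((expR (-1))%:E * (power_density q x)%:E))%E).
  rewrite ge0_integralZl//; last 2 first.
  - exact: measurable_power_densityE.
  - by move=> x _; rewrite lee_fin power_density_ge0.
  by rewrite integral_power_density// powR1 mule1 lte_fin expR_gt0.
apply: (@le_trans _ _ (\int[mu]_(x in [set` Interval (BRight 0%R) (BSide false 1%R)])
   (power_density q x * expR (- (1 * x)))%:E)%E).
  apply: ge0_le_integral => //.
  - by move=> x _; rewrite -EFinM lee_fin mulr_ge0 ?expR_ge0 ?power_density_ge0.
  - by apply: measurable_funeM; exact: measurable_power_densityE.
  - exact: mk.
  move=> x; rewrite /= in_itv/= => /andP[x0 x1].
  by rewrite -EFinM lee_fin mulrC ler_wpM2l ?power_density_ge0// ler_expR lerN2 mul1r.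
apply: ge0_subset_integral => //.
- exact: mk.
- by move=> x _; rewrite lee_fin mulr_ge0 ?expR_ge0 ?power_density_ge0.
- by move=> x; rewrite /= !in_itv/= => /andP[->].
Qed.

Lemma integral_power_density_expR q c : 0 < q -> 0 < c ->
  (\int[mu]_(x in `]0%R, +oo[) (power_density q x * expR (- (c * x)))%:E =
   (c `^ (- q) * Gamma (q + 1))%:E)%E.
Proof.
move=> q0 c0; rewrite integral_power_density_expR_Gamma_int// EFinM -Gamma_intE fineK//.
by rewrite ge0_fin_numE ?Gamma_int_ge0// Gamma_int_lty.
Qed.

Lemma Gamma_nat n : Gamma (n%:R + 1) = n`!%:R :> R.
Proof. by rewrite -Gamma_intE Gamma_int_nat. Qed.

End power_density_theory.

(** * Polynomial approximation of a step *)

Section bernstein.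
Variable R : realType.
Implicit Types (f g : nat -> R) (N : nat) (z c : R).

(** The mean of [f k] for [k] binomial with parameters [N] and [z], as a polynomial
    in [z] (the Bernstein polynomial of [f]). Conditioning on the first trial gives
    this recursion, which makes all properties below immediate inductions. *)
Fixpoint binomial_mean N f : {poly R} :=
  if N is N'.+1 then 'X * binomial_mean N' (f \o succn) + (1 - 'X) * binomial_mean N' f
  else (f 0%N)%:P.

Lemma binomial_meanS N f z :
  (binomial_mean N.+1 f).[z] = z * (binomial_mean N (f \o succn)).[z] + (1 - z) * (binomial_mean N f).[z].
Proof. by rewrite /= !hornerE. Qed.

Lemma binomial_mean_at0 N f : (binomial_mean N f).[0] = f 0%N.
Proof. by elim: N f => [|N IH] f; [rewrite /= hornerC|rewrite binomial_meanS IH mul0r subr0 mul1r add0r]. Qed.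

Lemma le_binomial_mean N f g z : 0 <= z <= 1 -> (forall k, f k <= g k) ->
  (binomial_mean N f).[z] <= (binomial_mean N g).[z].
Proof.
move=> /andP[z0 z1]; elim: N f g => [|N IH] f g fg; first by rewrite /= !hornerC.
by rewrite !binomial_meanS lerD// ler_wpM2l ?subr_ge0// IH// => k; exact: fg.
Qed.

Lemma binomial_mean_cst N c z : (binomial_mean N (fun=> c)).[z] = c.
Proof. by elim: N => [|N IH]; [rewrite /= hornerC|rewrite binomial_meanS !IH; ring]. Qed.

Lemma binomial_meanD N f g c z :
  (binomial_mean N (fun k => f k + c * g k)).[z] = (binomial_mean N f).[z] + c * (binomial_mean N g).[z].
Proof.
elim: N f g => [|N IH] f g; first by rewrite /= !hornerC.
by rewrite !binomial_meanS/= (IH (f \o succn) (g \o succn)) IH; ring.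
Qed.

Lemma binomial_mean_sqr N c z :
  (binomial_mean N (fun k => (k%:R - c) ^+ 2)).[z] = N%:R * z * (1 - z) + (N%:R * z - c) ^+ 2.
Proof.
elim: N c => [|N IH] c; first by rewrite /= hornerC; ring.
rewrite binomial_meanS IH.
have -> : (fun k => (k%:R - c) ^+ 2) \o succn = (fun k => (k%:R - (c - 1)) ^+ 2).
  by apply/funext => k /=; rewrite -natr1; ring.
by rewrite IH -natr1; ring.
Qed.

(** The Bernstein polynomial of the indicator of [k >= N * (a + b) / 2]. By
    Chebyshev's inequality it is within [z / (N * dl ^ 2)] of the step outside
    [a, b[, where [dl = (b - a) / 2]: the variance [N * z * (1 - z)] is at most
    [N * z]. An error proportional to [z], rather than constant, is what allows
    integration against infinite measures later. *)
Lemma polynomial_step a b e : 0 < a -> a < b -> 0 < e ->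
  exists Q : {poly R}, Q`_0 = 0 /\ forall z, 0 <= z <= 1 ->
    [/\ 0 <= Q.[z], (b <= z)%R%:R <= Q.[z] + e * z
      & Q.[z] <= (a <= z)%R%:R + e * z].
Proof.
move=> a0 ab e0.
have [th thE] : {th | th = (a + b) / 2} by exists ((a + b) / 2).
have [dl dlE] : {dl | dl = (b - a) / 2} by exists ((b - a) / 2).
have dl0 : 0 < dl by lra.
have th0 : 0 < th by lra.
(* chosen so that 1 / (N * dl ^ 2) <= e *)
pose N := (Num.truncn ((e * dl ^+ 2)^-1)).+1.
have N0 : 0 < N%:R :> R by rewrite ltr0n.
have Ne : (N%:R * dl ^+ 2)^-1 <= e.
  rewrite invf_ple ?posrE ?mulr_gt0 ?exprn_gt0//.
  rewrite -ler_pdivrMr ?exprn_gt0// -invfM.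
  exact/ltW/truncnS_gt.
pose f k : R := (N%:R * th <= k%:R)%R%:R.
pose v z k : R := (k%:R - N%:R * z) ^+ 2.
pose c : R := ((N%:R * dl) ^+ 2)^-1.
have c0 : 0 <= c by rewrite invr_ge0 sqr_ge0.
have vz z : 0 <= z <= 1 -> c * (binomial_mean N (v z)).[z] <= e * z.
  move=> /andP[z0 z1]; rewrite binomial_mean_sqr subrr expr0n addr0.
  rewrite (@le_trans _ _ ((N%:R * dl ^+ 2)^-1 * z))// ?ler_wpM2r//.
  have -> : c * (N%:R * z * (1 - z)) = (N%:R * dl ^+ 2)^-1 * z * (1 - z).
    by rewrite /c; field; rewrite !gt_eqF.
  by rewrite ler_piMr// ?lerBlDr ?lerDl// mulr_ge0// invr_ge0 mulr_ge0 ?sqr_ge0// ltW.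
have v0 z k : 0 <= v z k by rewrite sqr_ge0.
have far z k : N%:R * dl <= `|k%:R - N%:R * z| -> 1 <= c * v z k.
  move=> h; rewrite /c mulrC ler_pdivlMr ?exprn_gt0 ?mulr_gt0// mul1r.
  by rewrite /v -(real_normK (num_real (k%:R - _))) lerXn2r ?nnegrE ?mulr_ge0// ltW.
exists (binomial_mean N f); split.
  by rewrite -horner_coef0 binomial_mean_at0 /f leNgt mulr_gt0.
move=> z z01; split.
- by rewrite -(binomial_mean_cst N 0 z); apply: le_binomial_mean.
- have [bz|_] := leP b z; last first.
    rewrite addr_ge0 ?mulr_ge0 ?(ltW e0)//; last by case/andP: z01.
    by rewrite -(binomial_mean_cst N 0 z); apply: le_binomial_mean.
  rewrite -(binomial_mean_cst N 1 z) (le_trans _ (lerD (lexx _) (vz z z01)))//.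
  rewrite -binomial_meanD; apply: le_binomial_mean => // k.
  rewrite /f; case: (leP (N%:R * th)) => [_|kN]; first by rewrite lerDl mulr_ge0.
  rewrite add0r; apply: far.
  rewrite distrC ger0_norm; rewrite -?mulrBr.
    rewrite lerBrDr -lerBrDl (le_trans (ltW kN))// -mulrBr ler_wpM2l ?(ltW N0)//.
    by lra.
  by rewrite subr_ge0 (le_trans (ltW kN))// ler_wpM2l ?(ltW N0)//; lra.
- have [az|za] := leP a z.
    rewrite (@le_trans _ _ 1)// ?lerDl ?mulr_ge0 ?(ltW e0)//; last by case/andP: z01.
    by rewrite -(binomial_mean_cst N 1 z); apply: le_binomial_mean => // k; rewrite /f; case: (leP (N%:R * th)).
  rewrite add0r (le_trans _ (vz z z01))//.
  rewrite -[leRHS]add0r -[X in X + _](binomial_mean_cst N 0 z) -binomial_meanD; apply: le_binomial_mean => // k.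
  rewrite add0r /f; case: (leP (N%:R * th)) => [kN|_]; last by rewrite mulr_ge0.
  apply: far.
  have : N%:R * dl <= k%:R - N%:R * z.
    rewrite lerBrDr (le_trans _ kN)// -mulrDr ler_wpM2l ?(ltW N0)//.
    by lra.
  by move=> /le_trans; apply; exact: ler_norm.
Qed.
End bernstein.

(** * Integrals with a prescribed value *)

Section has_integral.
Context d (T : measurableType d) (R : realType) (m : {measure set T -> \bar R}).
Implicit Types (D : set T) (f g : T -> R).

(** Integrability and the value of the integral are always needed together; this
    pairing is closed under finite linear combinations with real scalars of any
    sign. *)
Definition has_integral D f (v : R) :=
  m.-integrable D (EFin \o f) /\ (\int[m]_(x in D) (f x)%:E = v%:E)%E.

Lemma has_integralE D f v : has_integral D f v -> (\int[m]_(x in D) (f x)%:E = v%:E)%E.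
Proof. by case. Qed.

Lemma eq_has_integral D f g v : f =1 g -> has_integral D f v -> has_integral D g v.
Proof. by move=> /funext ->. Qed.

Lemma has_integral_ge0 D f v : measurable D -> measurable_fun D f ->
  (forall x, D x -> 0 <= f x) -> (\int[m]_(x in D) (f x)%:E = v%:E)%E ->
  has_integral D f v.
Proof.
move=> mD mf f0 fv; split => //; apply/integrableP; split; first exact/measurable_EFinP.
rewrite (eq_integral (fun x => (f x)%:E)) ?fv ?ltry// => x; rewrite inE => Dx.
by rewrite /= ger0_norm ?f0.
Qed.

Lemma has_integralZ D f v c : measurable D -> has_integral D f v ->
  has_integral D (fun x => c * f x) (c * v).
Proof.
move=> mD [fi fv]; split.
  by have := integrableZl mD c fi; apply: eq_integrable => // x _.
under eq_integral do rewrite EFinM.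
by rewrite integralZl// fv EFinM.
Qed.

Lemma has_integralD D f g v w : measurable D -> has_integral D f v -> has_integral D g w ->
  has_integral D (fun x => f x + g x) (v + w).
Proof.
move=> mD [fi fv] [gi gv]; split.
  have := integrableD mD fi gi; apply: eq_integrable => // x _.
by rewrite (@integralD_EFin _ _ _ m D mD f g)// [X in (X + _)%E]fv [X in (_ + X)%E]gv EFinD.
Qed.

Lemma has_integral0 D : measurable D -> has_integral D (fun=> 0) 0.
Proof. by move=> mD; split; [exact: integrable0|rewrite integral0]. Qed.

Lemma has_integral_sum D (I : Type) (s : seq I) (f : I -> T -> R) (v : I -> R) : measurable D ->
  (forall i, has_integral D (f i) (v i)) ->
  has_integral D (fun x => \sum_(i <- s) f i x) (\sum_(i <- s) v i).
Proof.
move=> mD fv; elim: s => [|i s IH].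
  by rewrite big_nil; under eq_fun do rewrite big_nil; exact: has_integral0.
by rewrite big_cons; under eq_fun do rewrite big_cons; exact: has_integralD.
Qed.

Lemma le_has_integral D f v (g : T -> \bar R) : measurable D -> has_integral D f v ->
  measurable_fun D g -> (forall x, D x -> 0 <= g x)%E ->
  (forall x, D x -> g x <= (f x)%:E)%E ->
  (\int[m]_(x in D) g x <= v%:E)%E.
Proof.
move=> mD [fi <-] mg g0 gf; apply: ge0_le_integral => //; last first.
  exact: measurable_int fi.
Qed.

End has_integral.

Lemma has_integral_ae d (T : measurableType d) (R : realType)
    (m : {measure set T -> \bar R}) (f g : T -> R) v :
  measurable_fun setT g -> {ae m, forall w, f w = g w} ->
  has_integral m setT f v -> has_integral m setT g v.
Proof.
move=> mg fg [fi fv].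
have fgE : ae_eq m setT (EFin \o f) (EFin \o g).
  by apply: filterS fg => w /= -> .
have mf := measurable_int _ fi.
have mgE : measurable_fun setT (EFin \o g) by exact/measurable_EFinP.
split; last by rewrite -fv; apply/esym; exact: ae_eq_integral.
move/integrableP : fi => [_ fi]; apply/integrableP; split => //.
apply: le_lt_trans fi.
rewrite le_eqVlt; apply/orP; left; apply/eqP; apply: ae_eq_integral => //.
- exact: measurableT_comp.
- exact: measurableT_comp.
- by apply: filterS fg => w /= -> .
Qed.

Lemma has_integral_unique d (T : measurableType d) (R : realType)
    (m : {measure set T -> \bar R}) D (f : T -> R) a b :
  has_integral m D f a -> has_integral m D f b -> a = b.
Proof. by move=> [_ fa] [_]; rewrite fa => -[]. Qed.

Lemma has_integral1 d (T : measurableType d) (R : realType) (P : probability T R) :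
  has_integral P setT (fun=> 1) 1.
Proof.
apply: has_integral_ge0 => //.
by rewrite integral_cst// mul1e -[RHS](@probability_setT _ _ _ P).
Qed.

Lemma ge0_integralZ_EFin d (T : measurableType d) (R : realType)
    (m : {measure set T -> \bar R}) (f : T -> R) c :
  0 <= c -> measurable_fun setT f -> (forall w, 0 <= f w) ->
  (\int[m]_w (c * f w)%:E = c%:E * \int[m]_w (f w)%:E)%E.
Proof.
move=> c0 mf f0; under eq_integral do rewrite EFinM.
rewrite ge0_integralZl//; first exact/measurable_EFinP.
by move=> w _; rewrite lee_fin.
Qed.

Lemma ae_le_measure d (T : measurableType d) (R : realType) (m : {measure set T -> \bar R})
    (A B : set T) : measurable A -> measurable B ->
  {ae m, forall w, A w -> B w} -> (m A <= m B)%E.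
Proof.
move=> mA mB [N [mN N0 AB]].
have AU : A `<=` B `|` N.
  by move=> w Aw; apply: contrapT => /not_orP[Bw Nw]; apply: Nw; apply: AB => /(_ Aw).
rewrite (le_trans (le_measure m _ _ AU)) ?inE//; first exact: measurableU.
by rewrite (le_trans (measureU2 m mB mN))// [X in (_ + X)%E]N0 adde0.
Qed.

Lemma ae_eq_measure d (T : measurableType d) (R : realType)
    (m : {measure set T -> \bar R})
    (A B : set T) : measurable A -> measurable B ->
  {ae m, forall w, A w <-> B w} -> m A = m B.
Proof.
move=> mA mB AB; apply/eqP; rewrite eq_le; apply/andP; split; apply: ae_le_measure => //.
  by apply: filterS AB => w [].
by apply: filterS AB => w [].
Qed.

(** * Tail integrals from Laplace transforms *)

Section tail_comparison.
Context {R : realType} d (T : measurableType d) (P : probability T R).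
Local Notation mu := (@lebesgue_measure R).
Variables (Z : R -> T -> R) (q beta : R).
Hypothesis q0 : 0 < q.
Hypothesis mZ : forall x, measurable_fun setT (Z x).
Hypothesis Z01 : forall x w, 0 <= Z x w <= 1.
Hypothesis EZ : forall x k, 0 < x ->
  (\int[P]_w (Z x w ^+ k.+1)%:E = (expR (- (x * k.+1%:R `^ beta)))%:E)%E.

Lemma has_integral_power x k : 0 < x ->
  has_integral P setT (fun w => Z x w ^+ k.+1) (expR (- (x * k.+1%:R `^ beta))).
Proof.
move=> x0; apply: has_integral_ge0 => //; last exact: EZ.
- exact: measurable_funX.
- by move=> w _; rewrite exprn_ge0//; case/andP: (Z01 x w).
Qed.

Definition laplace_value (Q : {poly R}) x : R :=
  \sum_(k < size Q) Q`_k * expR (- (x * k%:R `^ beta)).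

Lemma has_integral_horner (Q : {poly R}) x : Q`_0 = 0 -> 0 < x ->
  has_integral P setT (fun w => Q.[Z x w]) (laplace_value Q x).
Proof.
move=> Q0 x0; under eq_fun do rewrite horner_coef.
apply: has_integral_sum => // -[[|k] /= _].
  by under eq_fun do rewrite Q0 mul0r; rewrite Q0 mul0r; exact: has_integral0.
by apply: has_integralZ => //; exact: has_integral_power.
Qed.

(** The number obtained by integrating [laplace_value Q] against the power
    density, up to [Gamma (q + 1)]. It depends on [q] and [beta] only through
    [q * beta]: two families with the same product are thereby compared. *)
Definition mellin_value (Q : {poly R}) : R :=
  \sum_(k < size Q) Q`_k * (k%:R `^ beta) `^ (- q).

Lemma has_integral_power_density_expR c : 0 < c ->
  has_integral mu `]0%R, +oo[ (fun x => power_density q x * expR (- (x * c))) (c `^ (- q) * Gamma (q + 1)).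
Proof.
move=> c0; apply: has_integral_ge0 => //.
- apply: measurable_funM; first exact: measurable_power_density.
  by apply: measurableT_comp => //; apply: measurableT_comp => //; exact: measurable_funM.
- by move=> x _; rewrite mulr_ge0 ?power_density_ge0 ?expR_ge0.
- by under eq_integral do rewrite mulrC [_ * c]mulrC mulrC; exact: integral_power_density_expR.
Qed.

Lemma has_integral_laplace_value (Q : {poly R}) : Q`_0 = 0 ->
  has_integral mu `]0%R, +oo[ (fun x => power_density q x * laplace_value Q x)
    (mellin_value Q * Gamma (q + 1)).
Proof.
move=> Q0; rewrite /mellin_value mulr_suml.
rewrite (_ : (fun x => _) = fun x =>
    \sum_(k < size Q) power_density q x * (Q`_k * expR (- (x * k%:R `^ beta)))); last first.
  by apply/funext => x; rewrite mulr_sumr.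
apply: has_integral_sum => // -[[|k] /= _].
  rewrite Q0 !mul0r; apply: (eq_has_integral (f := fun=> 0)).
    by move=> x; rewrite mul0r mulr0.
  exact: has_integral0.
apply: (@eq_has_integral _ (measurableTypeR R) R mu _ (fun x =>
    Q`_k.+1 * (power_density q x * expR (- (x * k.+1%:R `^ beta))))).
  by move=> x; rewrite mulrCA.
rewrite -mulrA; apply: has_integralZ => //.
by apply: has_integral_power_density_expR; rewrite powR_gt0.
Qed.

Lemma measurable_tail b x : measurable [set w | b <= Z x w].
Proof.
have := @measurable_fun_ler _ _ _ setT (cst b) (Z x) (measurable_cst _) (mZ x).
by move=> /(_ measurableT [set true]); rewrite setTI; apply.
Qed.

Lemma integral_tail b x : (\int[P]_w ((b <= Z x w)%R%:R)%:E = P [set w | (b <= Z x w)%R])%E.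
Proof.
transitivity (\int[P]_w (\1_[set w | b <= Z x w] w)%:E)%E; last first.
  by rewrite integral_indic// ?setIT//; exact: measurable_tail.
apply: eq_integral => w _; rewrite indicE; congr ((nat_of_bool _)%:R%:E).
by apply/idP/idP; rewrite inE.
Qed.

Lemma measurable_tail_fun b x : measurable_fun setT (fun w => (b <= Z x w)%R%:R : R).
Proof. by apply: measurable_natbool; exact: measurable_fun_ler. Qed.

Lemma has_integral_base x : 0 < x -> has_integral P setT (Z x) (expR (- x)).
Proof. by move=> x0; have := has_integral_power 0 x0; rewrite powR1 mulr1. Qed.

(** A polynomial above the step dominates the tail probability pointwise in [x];
    its mean under [Z x] is an explicit combination of exponentials, which the
    power density integrates exactly. *)
Lemma tail_integral_le (Q : {poly R}) b e (f : R -> \bar R) : 0 < e -> Q`_0 = 0 ->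
  (forall z, 0 <= z <= 1 -> (b <= z)%R%:R <= Q.[z] + e * z) ->
  measurable_fun [set: R] f -> (forall x, 0 < x -> (0 <= f x)%E) ->
  (forall x, 0 < x -> (f x <= P [set w | (b <= Z x w)%R])%E) ->
  (\int[mu]_(x in `]0%R, +oo[) ((power_density q x)%:E * f x) <=
   ((mellin_value Q + e) * Gamma (q + 1))%:E)%E.
Proof.
move=> e0 Q0 hQ mf f0 fP.
have hi : has_integral mu `]0%R, +oo[
    (fun x => power_density q x * laplace_value Q x + e * (power_density q x * expR (- (x * 1))))
    (mellin_value Q * Gamma (q + 1) + e * (1 `^ (- q) * Gamma (q + 1))).
  apply: has_integralD => //; first exact: has_integral_laplace_value.
  by apply: has_integralZ => //; exact: has_integral_power_density_expR.
have -> : (mellin_value Q + e) * Gamma (q + 1) =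
    mellin_value Q * Gamma (q + 1) + e * (1 `^ (- q) * Gamma (q + 1)).
  by rewrite powR1 mul1r mulrDl.
apply: (le_has_integral _ hi) => //.
- by apply: emeasurable_funM; [exact: measurable_power_densityE|exact: measurable_funTS].
- move=> x; rewrite /= in_itv/= andbT => x0; rewrite mule_ge0 ?f0//.
  by rewrite lee_fin power_density_ge0.
move=> x; rewrite /= in_itv/= andbT => x0.
have -> : power_density q x * laplace_value Q x + e * (power_density q x * expR (- (x * 1))) =
    power_density q x * (laplace_value Q x + e * expR (- x)) by rewrite mulr1; ring.
rewrite [leRHS]EFinM lee_wpmul2l ?lee_fin ?power_density_ge0//.
apply: (le_trans (fP x x0)); rewrite -integral_tail.
have hx : has_integral P setT (fun w => Q.[Z x w] + e * Z x w)
    (laplace_value Q x + e * expR (- x)).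
  apply: has_integralD => //; first exact: has_integral_horner.
  by apply: has_integralZ => //; exact: has_integral_base.
apply: (le_has_integral _ hx) => //.
- by apply/measurable_EFinP; exact: measurable_tail_fun.
- by move=> w _; rewrite lee_fin; exact/hQ/Z01.
Qed.

(** The matching lower bound, from a polynomial below the step. *)
Lemma tail_integral_ge (Q : {poly R}) a e (f : R -> \bar R) : 0 < e -> Q`_0 = 0 ->
  (forall z, 0 <= z <= 1 -> 0 <= Q.[z] <= (a <= z)%R%:R + e * z) ->
  measurable_fun [set: R] f -> (forall x, 0 < x -> (0 <= f x)%E) ->
  (forall x, 0 < x -> (P [set w | (a <= Z x w)%R] <= f x)%E) ->
  ((mellin_value Q * Gamma (q + 1))%:E <=
   \int[mu]_(x in `]0%R, +oo[) ((power_density q x)%:E * f x) + (e * Gamma (q + 1))%:E)%E.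
Proof.
move=> e0 Q0 hQ mf f0 fP.
have [_ <-] := has_integral_laplace_value Q0.
have [ie] : has_integral mu `]0%R, +oo[ (fun x => e * (power_density q x * expR (- (x * 1))))
    (e * (1 `^ (- q) * Gamma (q + 1))).
  by apply: has_integralZ => //; exact: has_integral_power_density_expR.
rewrite powR1 mul1r => <-.
have Lx x : 0 < x -> has_integral P setT (fun w => Q.[Z x w]) (laplace_value Q x).
  exact: has_integral_horner.
have L0 x : 0 < x -> 0 <= laplace_value Q x.
  move=> x0; rewrite -lee_fin; have [_ <-] := Lx x x0.
  by apply: integral_ge0 => w _; rewrite lee_fin; case/andP: (hQ _ (Z01 x w)).
rewrite -ge0_integralD//; last 4 first.
- move=> x; rewrite /= in_itv/= andbT => x0; rewrite mule_ge0 ?f0//.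
  by rewrite lee_fin power_density_ge0.
- by apply: emeasurable_funM; [exact: measurable_power_densityE|exact: measurable_funTS].
- by move=> x _; rewrite lee_fin mulr_ge0 ?(ltW e0)// mulr_ge0 ?expR_ge0// power_density_ge0.
- exact: measurable_int ie.
apply: ge0_le_integral => //.
- by move=> x; rewrite /= in_itv/= andbT => x0; rewrite lee_fin mulr_ge0 ?power_density_ge0 ?L0.
- by have [+ _] := has_integral_laplace_value Q0; exact: measurable_int.
- apply: emeasurable_funD; last exact: measurable_int ie.
  by apply: emeasurable_funM; [exact: measurable_power_densityE|exact: measurable_funTS].
move=> x; rewrite /= in_itv/= andbT => x0.
have -> : e * (power_density q x * expR (- (x * 1))) = power_density q x * (e * expR (- x)) by rewrite mulr1; ring.
rewrite [X in (X <= _)%E]EFinM [X in (_ <= _ + X)%E]EFinM -ge0_muleDr//; last 2 first.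
- exact: f0.
- by rewrite lee_fin mulr_ge0 ?expR_ge0// ltW.
rewrite lee_wpmul2l ?lee_fin ?power_density_ge0//.
rewrite (le_trans _ (leeD2r _ (fP x x0)))// -integral_tail.
have [ize vze] : has_integral P setT (fun w => e * Z x w) (e * expR (- x)).
  by apply: has_integralZ => //; exact: has_integral_base.
rewrite -vze -ge0_integralD//; last 3 first.
- by apply/measurable_EFinP; exact: measurable_tail_fun.
- by move=> w _; rewrite lee_fin mulr_ge0 ?(ltW e0)//; case/andP: (Z01 x w).
- exact: measurable_int ize.
have [iQ <-] := Lx x x0.
apply: ge0_le_integral => //.
- by move=> w _; rewrite lee_fin; case/andP: (hQ _ (Z01 x w)).
- exact: measurable_int iQ.
- apply: emeasurable_funD; last exact: measurable_int ize.
  by apply/measurable_EFinP; exact: measurable_tail_fun.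
- by move=> w _; rewrite -EFinD lee_fin; case/andP: (hQ _ (Z01 x w)).
Qed.

End tail_comparison.

(** * Moments of the inverse stable subordinator *)

Lemma first_passage_ge0 (R : realType) (f : R -> R) t : 0 <= inf [set x | 0 <= x /\ t < f x].
Proof.
have [->|/set0P ne] := eqVneq [set x | 0 <= x /\ t < f x] set0; first by rewrite inf0.
by apply: lb_le_inf => // x [].
Qed.

Section inverse_stable.
Context {R : realType} d (T : measurableType d) (P : probability T R).
Local Notation mu := (@lebesgue_measure R).
Variables (alpha : R) (D : process P) (Y : process P).
Hypothesis alpha0 : 0 < alpha.
Hypothesis stableD : stable_subordinator alpha D.
Hypothesis YE : forall t w, 0 <= t -> Y t w = inf [set x | 0 <= x /\ t < D x w].

Let Z (x : R) (w : T) : R := expR (- Num.max (D x w) 0).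

Let mZ x : measurable_fun setT (Z x).
Proof.
apply: measurableT_comp => //; apply: measurableT_comp => //.
exact: measurable_maxr.
Qed.

Let Z01 x w : 0 <= Z x w <= 1.
Proof. by rewrite expR_ge0 /= -expR0 ler_expR oppr_le0 le_max lexx orbT. Qed.

Let ZE a x w : 0 <= a -> (expR (- a) <= Z x w) = (D x w <= a).
Proof. by move=> a0; rewrite /Z ler_expR lerN2 ge_max a0 andbT. Qed.

Let good : {ae P, forall w, (D 0 w = 0) /\ (forall s t, 0 <= s -> s <= t -> D s w <= D t w)}.
Proof.
case: stableD => -[D0 _ _ _ _] mono _.
by apply: filterS2 D0 mono => w.
Qed.

Let EZ x k : 0 < x ->
  (\int[P]_w (Z x w ^+ k.+1)%:E = (expR (- (x * k.+1%:R `^ alpha)))%:E)%E.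
Proof.
move=> x0; case: stableD => _ _ /(_ k.+1%:R x (ltr0Sn _ _) (ltW x0)).
rewrite unlock => <-; apply: ae_eq_integral => //.
- by apply/measurable_EFinP; exact: measurable_funX.
- apply/measurable_EFinP; apply: measurableT_comp => //; apply: measurableT_comp => //.
  exact: measurable_funM.
apply: filterS good => w [D0 mono] _; congr EFin.
rewrite /Z -expRM_natl mulrN; congr (expR (- (_ * _))).
by apply/max_idPl; rewrite -D0 mono// ltW.
Qed.

Let Y_ge0 t w : 0 <= t -> 0 <= Y t w.
Proof.
by move=> t0; rewrite YE//; exact: first_passage_ge0.
Qed.

(** The duality between first passage times and the process, in one direction;
    the converse [Y_ge] uses monotonicity and the divergence of the paths, and
    holds only with a weak inequality. *)
Let Y_gt t x w : 0 <= t -> 0 < x -> x < Y t w -> D x w <= t.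
Proof.
move=> t0 x0; rewrite leNgt; apply: contraTN => tD.
rewrite -leNgt YE//; apply: ge_inf; last by split => //; exact: ltW.
by exists 0 => y [].
Qed.

(** Markov's inequality for [exp (- D m)], whose mean is [exp (- m)]. *)
Let unbounded t : 0 <= t -> {ae P, forall w, exists x, 0 <= x /\ t < D x w}.
Proof.
move=> t0; pose N := \bigcap_(m : nat) [set w | expR (- t) <= Z m.+1%:R w].
have mN : measurable N by apply: bigcap_measurable => // m _; exact: measurable_tail.
exists N; split => //; last first.
  move=> w /= /forallNP ne m _ /=; rewrite ZE// leNgt; apply/negP => tD.
  by apply: (ne m.+1%:R).
apply/eqP; rewrite eq_le measure_ge0 andbT; apply/lee_addgt0Pr => e e0; rewrite add0e.
pose m := Num.truncn (expR t / e).
have mx : 0 < m.+1%:R :> R by [].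
apply: (@le_trans _ _ (P [set w | expR (- t) <= Z m.+1%:R w])).
  by apply: le_measure; rewrite ?inE//; [exact: measurable_tail|move=> w; apply].
rewrite -integral_tail//.
have h : has_integral P setT (fun w => expR t * Z m.+1%:R w) (expR t * expR (- m.+1%:R)).
  by apply: has_integralZ => //; exact: has_integral_base EZ _ _.
apply: (@le_trans _ _ (expR t * expR (- m.+1%:R))%:E).
  apply: (le_has_integral _ h) => //.
  - by apply/measurable_EFinP; exact: measurable_tail_fun.
  - move=> w _; rewrite lee_fin; case: (leP (expR (- t))) => [h1|_]; last first.
      by rewrite mulr_ge0 ?expR_ge0.
    by rewrite mulrC -ler_pdivrMr ?expR_gt0// div1r -expRN.
rewrite lee_fin expRN ler_pdivrMr ?expR_gt0// mulrC -ler_pdivrMr//.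
rewrite (le_trans (ltW (truncnS_gt _)))//.
by rewrite (le_trans _ (expR_ge1Dx _))// lerDr.
Qed.

Let Y_ge t x : 0 <= t -> 0 < x -> {ae P, forall w, D x w <= t -> x <= Y t w}.
Proof.
move=> t0 x0; apply: filterS2 good (unbounded t0) => w [_ mono] ne Dx.
rewrite YE//; apply: lb_le_inf => // y [y0 tD].
by rewrite leNgt; apply/negP => yx; have := lt_le_trans tD (le_trans (mono _ _ y0 (ltW yx)) Dx); rewrite ltxx.
Qed.

Variables (n : nat) (n0 : (0 < n)%N).
Let p := n%:R * alpha.
Let p0 : 0 < p. Proof. by rewrite mulr_gt0 ?ltr0n. Qed.
Let nR0 : 0 < n%:R :> R. Proof. by rewrite ltr0n. Qed.

(** The deterministic motion [x |-> x] in the role of the subordinator, with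
    exponent [1] and the density of order [p = n * alpha]: it has the same Mellin
    values as the stable subordinator with the density of order [n], and its tail
    integral is the explicit [a ^ p]. *)
Let Z' (x : R) (w : T) : R := expR (- Num.max x 0).

Let mZ' x : measurable_fun setT (Z' x).
Proof. exact: measurable_cst. Qed.

Let Z'01 x w : 0 <= Z' x w <= 1.
Proof. by rewrite expR_ge0 /= -expR0 ler_expR oppr_le0 le_max lexx orbT. Qed.

Let EZ' x k : 0 < x ->
  (\int[P]_w (Z' x w ^+ k.+1)%:E = (expR (- (x * k.+1%:R `^ 1)))%:E)%E.
Proof.
move=> x0; rewrite (@integral_cst _ _ _ P setT measurableT (Z' x point ^+ k.+1)%:E) [X in (_ * X)%E]probability_setT mule1.
have -> : Z' x point = expR (- x) by rewrite /Z' (max_idPl (ltW x0)).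
by rewrite powRr1// -expRM_natl mulrN mulrC.
Qed.

Let tail' a x : 0 <= a -> 0 < x -> P [set w | expR (- a) <= Z' x w] = ((x <= a)%R%:R)%:E.
Proof.
move=> a0 x0; rewrite -integral_tail// (eq_integral (cst ((x <= a)%R%:R)%:E)).
  by rewrite integral_cst// [X in (_ * X)%E]probability_setT mule1.
by move=> w _; rewrite /Z' ler_expR lerN2 ge_max a0 andbT.
Qed.

Let integral_step a : 0 <= a ->
  (\int[mu]_(x in `]0%R, +oo[) ((power_density p x)%:E * ((x <= a)%R%:R)%:E) = (a `^ p)%:E)%E.
Proof.
move=> a0; rewrite -(integral_power_density false p0 a0).
rewrite integral_mkcond [RHS]integral_mkcond; apply: eq_integral => x _.
rewrite !patchE.
have -> : (x \in `]0%R, +oo[%classic) = (0 < x).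
  by apply/idP/idP; rewrite inE/= in_itv/= andbT.
have -> : (x \in [set` Interval (BRight 0) (BSide false a)]) = (0 < x) && (x <= a).
  by apply/idP/idP; rewrite inE/= in_itv.
by case: (0 < x) => //=; case: (x <= a); rewrite ?mule1 ?mule0.
Qed.

Let mstep a : measurable_fun [set: R] (fun x : R => ((x <= a)%R%:R : R)%:E).
Proof. by apply/measurable_EFinP; apply: measurable_natbool; exact: measurable_fun_ler. Qed.

Let mellinE (Q : {poly R}) : mellin_value n%:R alpha Q = mellin_value p 1 Q.
Proof.
have E (k : nat) : (k%:R `^ alpha) `^ (- n%:R) = (k%:R `^ 1) `^ (- p).
  by rewrite -(powRrM _ alpha) -(powRrM _ 1) mulrN mul1r mulrC.
by apply: eq_bigr => k _; rewrite E.
Qed.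

Let moment t := (\int[P]_w (Y t w ^+ n)%:E)%E.

Let moment_tail b t : 0 <= t -> moment t =
  (\int[mu]_(x in `]0%R, +oo[) ((power_density n%:R x)%:E * \int[P]_w ((above b x (Y t w))%:R)%:E))%E.
Proof.
move=> t0.
have := @layer_cake R _ T P (fun=> 1) (Y t) b n%:R nR0 (measurable_cst _)
  (measurable_funPT _) (fun _ => ler01) (fun w => Y_ge0 w t0).
rewrite /moment; under eq_integral do rewrite mul1r powR_mulrn ?Y_ge0//.
move=> ->; apply: eq_integral => x _; congr (_ * _)%E.
by apply: eq_integral => w _; rewrite mul1r.
Qed.

Let mabove b t x : measurable [set w | above b x (Y t w)].
Proof.
have := @measurable_above R b _ _ setT (cst x) (Y t) (measurable_cst _) (measurable_funPT _).
by move=> /(_ measurableT [set true]); rewrite setTI; apply.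
Qed.

Let tailE b t x : (\int[P]_w ((above b x (Y t w))%:R : R)%:E = P [set w | above b x (Y t w)])%E.
Proof.
transitivity (\int[P]_w (\1_[set w | above b x (Y t w)] w)%:E)%E; last first.
  by rewrite integral_indic// ?setIT.
apply: eq_integral => w _; rewrite indicE; congr ((nat_of_bool _)%:R%:E).
by apply/idP/idP; rewrite inE.
Qed.

Let mtail b t : measurable_fun [set: R] (fun x => P [set w | above b x (Y t w)])%E.
Proof.
pose g x := fine (P [set w | above b x (Y t w)]).
apply: (@eq_measurable_fun _ _ _ _ _ (EFin \o g)).
  by move=> x _; rewrite /g /= fineK// fin_num_measure.
apply/measurable_EFinP; apply: nonincreasing_measurable => // x y xy.
rewrite /g fine_le ?fin_num_measure// le_measure ?inE// => w /=.
by rewrite /above; case: (b) => yY; [exact: le_lt_trans yY|exact: le_trans yY].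
Qed.

Let moment_tailP b t : 0 <= t -> moment t =
  (\int[mu]_(x in `]0%R, +oo[) ((power_density n%:R x)%:E * P [set w | above b x (Y t w)]))%E.
Proof. by move=> t0; rewrite (moment_tail b t0); apply: eq_integral => x _; rewrite tailE. Qed.

Let G := Gamma (p + 1).
Let G0 : 0 < G. Proof. exact: Gamma_gt0. Qed.

(** The approximating polynomial lies between the steps at [exp (- t)] and at
    [exp (- a)], so it bounds the moment at [t] from above and the explicit
    integral at [a] from below, both with the same Mellin value. *)
Let moment_upper t a e : 0 <= t -> t < a -> 0 < e ->
  (moment t <= ((a `^ p / G + 2 * e) * n`!%:R)%:E)%E.
Proof.
move=> t0 ta e0; have a0 : 0 <= a := le_trans t0 (ltW ta).
have [|Q [Q0 hQ]] := polynomial_step (expR_gt0 (- a)) _ e0 (b := expR (- t)).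
  by rewrite ltr_expR ltrN2.
have up : (moment t <= ((mellin_value n%:R alpha Q + e) * Gamma (n%:R + 1))%:E)%E.
  rewrite (moment_tailP true t0); apply: (tail_integral_le nR0 mZ Z01 EZ e0 Q0 (b := expR (- t))) => //.
  - by move=> z /hQ[].
  - move=> x x0; apply: le_measure; rewrite ?inE//; first exact: measurable_tail.
    by move=> w /=; rewrite ZE// /above; exact: Y_gt.
have lo : ((mellin_value p 1 Q * G)%:E <= (a `^ p + e * G)%:E)%E.
  rewrite EFinD -integral_step//.
  apply: (tail_integral_ge p0 mZ' Z'01 EZ' e0 Q0 (a := expR (- a))) => //.
  - by move=> z /hQ[-> _ ->].
  - by move=> x x0; rewrite tail'.
apply: (le_trans up); rewrite Gamma_nat lee_fin ler_wpM2r// mellinE.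
have : mellin_value p 1 Q <= a `^ p / G + e.
  by rewrite -(ler_pM2r G0) mulrDl divfK ?gt_eqF// -lee_fin.
lra.
Qed.

Let moment_lower t a e : 0 <= a -> a < t -> 0 < e ->
  (((a `^ p / G - 2 * e) * n`!%:R)%:E <= moment t)%E.
Proof.
move=> a0 ta e0; have t0 : 0 <= t := le_trans a0 (ltW ta).
have [|Q [Q0 hQ]] := polynomial_step (expR_gt0 (- t)) _ e0 (b := expR (- a)).
  by rewrite ltr_expR ltrN2.
have lo : ((mellin_value n%:R alpha Q * Gamma (n%:R + 1))%:E <= moment t + (e * Gamma (n%:R + 1))%:E)%E.
  rewrite (moment_tailP false t0).
  apply: (tail_integral_ge nR0 mZ Z01 EZ e0 Q0 (a := expR (- t))) => //.
  - by move=> z /hQ[-> _ ->].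
  - move=> x x0; apply: ae_le_measure => //; first exact: measurable_tail.
    by apply: filterS (Y_ge t0 x0) => w /=; rewrite ZE.
have up : ((a `^ p)%:E <= ((mellin_value p 1 Q + e) * G)%:E)%E.
  rewrite -integral_step//; apply: (tail_integral_le p0 mZ' Z'01 EZ' e0 Q0 (b := expR (- a))) => //.
  - by move=> z /hQ[].
  - by move=> x x0; rewrite tail'.
move: lo; rewrite Gamma_nat -leeBlDr// => /(le_trans _); apply.
rewrite -EFinB lee_fin -mulrBl ler_wpM2r// mellinE.
have : a `^ p / G <= mellin_value p 1 Q + e.
  by rewrite ler_pdivrMr// -lee_fin.
lra.
Qed.

Let powR_root x : 0 <= x -> (x `^ p^-1) `^ p = x.
Proof. by move=> x0; rewrite -powRrM mulVf ?gt_eqF// powRr1. Qed.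

(** Both bounds hold for all [a] beyond (resp. below) [t] and all [e]; [a] is taken
    of the form [(t ^ p +- h) ^ (1 / p)], which makes the limit explicit and
    covers [t = 0]. *)
Lemma inverse_stable_moment t : 0 <= t ->
  has_integral P setT (fun w => Y t w ^+ n) (n`!%:R / Gamma (n%:R * alpha + 1) * t `^ (n%:R * alpha)).
Proof.
move=> t0; rewrite -/p -/G.
have f0 : 0 < n`!%:R :> R by rewrite ltr0n fact_gt0.
have tp0 := powR_ge0 t p.
apply: has_integral_ge0 => //.
- exact: measurable_funX.
- by move=> w _; rewrite exprn_ge0// Y_ge0.
rewrite -/(moment t); apply/eqP; rewrite eq_le; apply/andP; split.
  apply/lee_addgt0Pr => e e0.
  (* h and e' are such that the two error terms add up to e *)
  pose h := e * G / (2 * n`!%:R); pose e' := e / (4 * n`!%:R).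
  have h0 : 0 < h by rewrite !mulr_gt0 ?invr_gt0// mulr_gt0.
  have e'0 : 0 < e' by rewrite divr_gt0// mulr_gt0.
  apply: (le_trans (moment_upper (a := (t `^ p + h) `^ p^-1) t0 _ e'0)).
    rewrite -[X in X < _](powRr1 t0) -(mulfV (lt0r_neq0 p0)) (powRrM t p).
    by rewrite gt0_ltr_powR ?invr_gt0// ?nnegrE ?addr_ge0 ?(ltW h0)// ltrDl.
  rewrite powR_root ?addr_ge0 ?(ltW h0)// -EFinD lee_fin le_eqVlt; apply/orP; left.
  by apply/eqP; rewrite /h /e'; field; rewrite !gt_eqF.
have [t00|tpos] := eqVneq t 0.
  by rewrite t00 powR0 ?gt_eqF// mulr0 integral_ge0// => w _; rewrite lee_fin exprn_ge0// Y_ge0.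
have {}tpos : 0 < t by rewrite lt_neqAle eq_sym tpos.
apply/lee_addgt0Pr => e e0.
pose h := Num.min (t `^ p) (e * G / (2 * n`!%:R)); pose e' := e / (4 * n`!%:R).
have h0 : 0 < h.
  by rewrite lt_min powR_gt0// !mulr_gt0 ?invr_gt0// mulr_gt0.
have ht : 0 <= t `^ p - h by rewrite subr_ge0 ge_min lexx.
have e'0 : 0 < e' by rewrite divr_gt0// mulr_gt0.
have at_ : (t `^ p - h) `^ p^-1 < t.
  rewrite -[X in _ < X](powRr1 t0) -(mulfV (lt0r_neq0 p0)) (powRrM t p).
  by rewrite gt0_ltr_powR ?invr_gt0// ?nnegrE// gtrBl.
have := moment_lower (powR_ge0 _ _) at_ e'0.
rewrite powR_root// => /(leeD2r e%:E); apply: le_trans.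
rewrite -EFinD lee_fin.
have hE : h <= e * G / (2 * n`!%:R) by rewrite ge_min lexx orbT.
have -> : n`!%:R / G * t `^ p =
  ((t `^ p - e * G / (2 * n`!%:R)) / G - 2 * e') * n`!%:R + e.
  by rewrite /e'; field; rewrite !gt_eqF.
rewrite lerD2r ler_wpM2r ?(ltW f0)// lerD2r ler_wpM2r ?invr_ge0 ?(ltW G0)//.
by rewrite lerD2l lerN2.
Qed.

End inverse_stable.

(** * Means of functions of independent variables *)

Section truncn.
Context {R : realType}.

Lemma measurable_truncn : measurable_fun [set: R] (Num.truncn : R -> nat).
Proof.
have mle n : measurable [set x : R | (Num.truncn x <= n)%N].
  rewrite (_ : [set _ | _] = `]-oo, n.+1%:R[%classic)//.
  by apply/seteqP; split => x; rewrite /= in_itv/= truncn_le_nat.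
have meq n : measurable [set x : R | Num.truncn x = n].
  case: n => [|n].
    rewrite (_ : [set _ | _] = [set x : R | (Num.truncn x <= 0)%N])//.
    by apply/seteqP; split => x /=; rewrite leqn0 => /eqP.
  rewrite (_ : [set _ | _] = [set x : R | (Num.truncn x <= n.+1)%N] `\` [set x : R | (Num.truncn x <= n)%N]).
    exact: measurableD.
  apply/seteqP; split => x /=; first by move=> ->; split => //; rewrite ltnn.
  by move=> [h1 /negP]; rewrite -ltnNge => h2; apply/eqP; rewrite eqn_leq h1.
move=> _ B _; rewrite setTI.
rewrite (_ : _ @^-1` B = \bigcup_(n in B) [set x : R | Num.truncn x = n]).
  exact: bigcup_measurable.
by apply/seteqP; split => [x Bx|x [n Bn xn]]; [exists (Num.truncn x)|rewrite /= xn].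
Qed.

Lemma measurable_truncn_comp d (T : measurableType d) (f : T -> R) (h : nat -> R) :
  measurable_fun setT f -> measurable_fun setT (fun w => h (Num.truncn (f w))).
Proof.
move=> mf.
have mh : measurable_fun setT (fun x : R => h (Num.truncn x)).
  by apply: (measurableT_comp (f := h)) => //; exact: measurable_truncn.
exact: (measurableT_comp mh mf).
Qed.
End truncn.

Section law.
Context {R : realType}.
Local Notation mu := (@lebesgue_measure R).

Lemma measurable_superlevel (phi : R -> R) x : measurable_fun setT phi ->
  measurable [set y | x < phi y].
Proof.
move=> mphi; have := @measurable_fun_ltr _ _ _ setT (cst x) phi (measurable_cst _) mphi.
by move=> /(_ measurableT [set true]); rewrite setTI; apply.
Qed.

(** The hypothesis is independence of [W] from the events of [X] with [c] the mean
    of [W]. Writing [phi (X w)] as the integral of the indicators of its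
    superlevel sets reduces the claim to these events. *)
Lemma indep_integral d (T : measurableType d) (P : probability T R) (X W : T -> R)
    (phi : R -> R) c : 0 <= c ->
  measurable_fun setT X -> measurable_fun setT W -> (forall w, 0 <= W w) ->
  measurable_fun setT phi -> (forall x, 0 <= phi x) ->
  (forall A, measurable A ->
     (\int[P]_w (W w * \1_A (X w))%:E = c%:E * P (X @^-1` A))%E) ->
  (\int[P]_w (W w * phi (X w))%:E = c%:E * \int[P]_w (phi (X w))%:E)%E.
Proof.
move=> c0 mX mW W0 mphi phi0 indep.
have mpX : measurable_fun setT (phi \o X) by exact: measurableT_comp.
have pX0 w : 0 <= phi (X w) by [].
have indE x w : (above true x (phi (X w)))%:R = \1_[set y | x < phi y] (X w) :> R.
  by rewrite indicE /above; congr (nat_of_bool _)%:R; apply/idP/idP; rewrite inE.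
have := @layer_cake R _ T P W (phi \o X) true 1 ltr01 mW mpX W0 pX0.
under eq_integral do rewrite /= powRr1//.
move=> ->.
have := @layer_cake R _ T P (fun=> c) (phi \o X) true 1 ltr01 (measurable_cst _) mpX (fun=> c0) pX0.
under eq_integral do rewrite /= powRr1//.
rewrite ge0_integralZ_EFin//.
move=> ->; apply: eq_integral => x _; congr (_ * _)%E.
under eq_integral do rewrite /= indE.
under [RHS]eq_integral do rewrite /= indE.
have mA := measurable_superlevel x mphi.
rewrite indep// ge0_integralZ_EFin//; last first.
  by apply: (measurableT_comp _ mX); exact: measurable_indic.
congr (_ * _)%E.
transitivity (\int[P]_w (\1_(X @^-1` [set y | x < phi y]) w)%:E)%E => //.
rewrite integral_indic// ?setIT//.
by rewrite -[X in measurable X]setTI; exact: mX.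
Qed.

(** Same reduction to superlevel sets: two variables with the same law give the
    same means. *)
Lemma law_integral d (T : measurableType d) (P : probability T R)
    d' (T' : measurableType d') (P' : probability T' R) (X : T -> R) (X' : T' -> R) (phi : R -> R) :
  measurable_fun setT X -> measurable_fun setT X' ->
  measurable_fun setT phi -> (forall x, 0 <= phi x) ->
  (forall A, measurable A -> P (X @^-1` A) = P' (X' @^-1` A)) ->
  (\int[P]_w (phi (X w))%:E = \int[P']_w (phi (X' w))%:E)%E.
Proof.
move=> mX mX' mphi phi0 law.
have tail dd (TT : measurableType dd) (Q : probability TT R) (V : TT -> R) :
    measurable_fun setT V ->
    (\int[Q]_w (phi (V w))%:E = \int[mu]_(x in `]0%R, +oo[)
      ((power_density 1 x)%:E * Q (V @^-1` [set y | (x < phi y)%R])))%E.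
  move=> mV.
  have mpV : measurable_fun setT (phi \o V) by exact: measurableT_comp.
  have := @layer_cake R _ TT Q (fun=> 1) (phi \o V) true 1 ltr01 (measurable_cst _) mpV
    (fun=> ler01) (fun w => phi0 (V w)).
  under eq_integral do rewrite /= powRr1// mul1r.
  move=> ->; apply: eq_integral => x _; congr (_ * _)%E.
  transitivity (\int[Q]_w (\1_(V @^-1` [set y | x < phi y]) w)%:E)%E.
    apply: eq_integral => w _; rewrite mul1r indicE /above; congr ((nat_of_bool _)%:R%:E).
    by apply/idP/idP; rewrite inE.
  rewrite integral_indic// ?setIT//.
  by rewrite -[X in measurable X]setTI; apply: mV => //; exact: measurable_superlevel.
rewrite !tail//; apply: eq_integral => x _; congr (_ * _)%E.
by apply: law; exact: measurable_superlevel.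
Qed.

(** Starting from indicators, for which this is mutual independence, the factors
    are replaced by general nonnegative functions one index at a time: [n] counts
    the factors already replaced. *)
Lemma indep_prod_integral d (T : measurableType d) (P : probability T R) k
    (X : 'I_k -> T -> R) (f : 'I_k -> R -> R) (v : 'I_k -> R) n :
  (forall i, measurable_fun setT (X i)) ->
  (forall A : 'I_k -> set R, (forall i, measurable (A i)) ->
     P (\bigcap_i (X i @^-1` A i)) = (\prod_i P (X i @^-1` A i))%E) ->
  (forall i, measurable_fun setT (f i)) -> (forall i x, 0 <= f i x) ->
  (forall i, \int[P]_w (f i (X i w))%:E = (v i)%:E)%E ->
  (forall i : 'I_k, (n <= i)%N -> exists2 A, measurable A & f i = \1_A) ->
  (\int[P]_w (\prod_i f i (X i w))%:E = (\prod_i v i)%:E)%E.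
Proof.
move=> mX indep.
have mpre i A : measurable A -> measurable (X i @^-1` A).
  by move=> mA; rewrite -[X in measurable X]setTI; exact: mX.
have int_ind i A : measurable A -> (\int[P]_w (\1_A (X i w) : R)%:E = P (X i @^-1` A))%E.
  move=> mA; transitivity (\int[P]_w (\1_(X i @^-1` A) w)%:E)%E => //.
  by rewrite integral_indic// ?setIT//; exact: mpre.
elim: n f v => [|n IH] f v mf f0 fv find.
  have /choice[A HA] : forall i, exists A, measurable A /\ f i = \1_A.
    by move=> i; have [A mA fA] := find i (leq0n _); exists A.
  have mA i : measurable (A i) by case: (HA i).
  have fA i : f i = \1_(A i) by case: (HA i).
  transitivity (\int[P]_w (\1_(\bigcap_i (X i @^-1` A i)) w)%:E)%E.
    apply: eq_integral => w _; congr EFin; rewrite indicE.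
    have [wA|wA] := boolP (w \in _).
      rewrite inE in wA; apply: big1 => i _.
      by rewrite fA indicE mem_set//; exact: wA.
    have [i nA] : exists i, ~ A i (X i w).
      by apply/existsNP => h; move/negP: wA; apply; rewrite inE => i _; exact: h.
    by rewrite (bigD1 i)//= fA indicE memNset// mul0r.
  rewrite integral_indic//; last by apply: fin_bigcap_measurable => // i _; exact: mpre.
  transitivity (P (\bigcap_i (X i @^-1` A i))); first by rewrite setIT.
  rewrite (indep A mA) -prodEFin; apply: eq_bigr => i _.
  by rewrite -int_ind// -fv fA.
have [nk|kn] := ltnP n k; last first.
  by apply: IH => // i ni; have := leq_trans kn ni; rewrite leqNgt ltn_ord.
pose j := Ordinal nk.
pose W w := \prod_(i < k | i != j) f i (X i w).
pose c := \prod_(i < k | i != j) v i.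
have v0 i : 0 <= v i by rewrite -lee_fin -fv integral_ge0// => w _; rewrite lee_fin.
transitivity (\int[P]_w (W w * f j (X j w))%:E)%E.
  by apply: eq_integral => w _; rewrite (bigD1 j)//= mulrC.
rewrite (@indep_integral _ _ _ (X j) W (f j) c)//.
- by rewrite fv -EFinM /c [in RHS](bigD1 j)//= mulrC.
- exact: prodr_ge0.
- have -> : W = fun w => \prod_(i <- index_enum 'I_k) (if i != j then f i (X i w) else 1).
    by apply/funext => w; rewrite /W big_mkcond.
  apply: measurable_prod => i _; case: (i != j) => //; exact: measurableT_comp.
- by move=> w; exact: prodr_ge0.
move=> A mA.
pose f' i := if i == j then \1_A else f i.
pose v' i := if i == j then fine (P (X j @^-1` A)) else v i.
have := IH f' v'.
have -> : (\prod_i v' i)%:E = (c%:E * P (X j @^-1` A))%E.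
  rewrite (bigD1 j)//= /v' eqxx mulrC EFinM fineK ?fin_num_measure//; last exact: mpre.
  by congr (_%:E * _)%E; apply: eq_bigr => i /negbTE ->.
have -> : (\int[P]_w (\prod_i f' i (X i w))%:E = \int[P]_w (W w * \1_A (X j w))%:E)%E.
  apply: eq_integral => w _; rewrite (bigD1 j)//= /f' eqxx mulrC; congr (_ * _)%:E.
  by apply: eq_bigr => i /negbTE ->.
apply.
- by move=> i; rewrite /f'; case: eqP => // _; exact: measurable_indic.
- by move=> i x; rewrite /f'; case: eqP.
- move=> i; rewrite /f' /v'; case: eqP => [->|_]; last exact: fv.
  by rewrite int_ind// fineK// fin_num_measure//; exact: mpre.
- move=> i ni; rewrite /f'; case: eqVneq => [_|ij]; first by exists A.
  apply: find; rewrite ltn_neqAle ni andbT; apply: contraNneq ij => nE.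
  by apply/eqP/val_inj.
Qed.

Lemma integral_nat_valued d (T : measurableType d) (P : probability T R) (X : T -> R) (h : nat -> R) :
  measurable_fun setT X -> (forall n, 0 <= h n) ->
  {ae P, forall w, exists n : nat, X w = n%:R} ->
  (\int[P]_w (h (Num.truncn (X w)))%:E = \sum_(0 <= n <oo) ((h n)%:E * P (X @^-1` [set n%:R])))%E.
Proof.
move=> mX h0 Xnat.
have mB n : measurable (X @^-1` [set n%:R]).
  by rewrite -[X in measurable X]setTI; apply: mX.
transitivity (\int[P]_w (\sum_(0 <= n <oo) (h n * \1_(X @^-1` [set n%:R]) w)%:E))%E.
  apply: ae_eq_integral => //.
  - by apply/measurable_EFinP; exact: measurable_truncn_comp.
  - apply: ge0_emeasurable_sum => // n.
      by move=> w _ _; rewrite lee_fin mulr_ge0.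
    by move=> _; apply/measurable_EFinP; apply: measurable_funM => //; exact: measurable_indic.
  apply: filterS Xnat => w [n Xn] _.
  rewrite Xn natrK.
  rewrite (@nneseriesD1 _ _ n)//; last by move=> m _; rewrite lee_fin mulr_ge0.
  rewrite indicE mem_set//= mulr1 eseries0 ?adde0// => m _ mn.
  rewrite indicE memNset ?mulr0//= Xn => /eqP; rewrite eqr_nat => /eqP nm.
  by move: mn; rewrite nm eqxx.
rewrite integral_nneseries//; last 2 first.
- by move=> n; apply/measurable_EFinP; apply: measurable_funM => //; exact: measurable_indic.
- by move=> n w _; rewrite lee_fin mulr_ge0.
apply: eq_eseriesr => n _; rewrite ge0_integralZ_EFin//.
by rewrite integral_indic// setIT.
Qed.

End law.

(** * Factorial moments of counting and Skellam processes *)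

Section poisson_moments.
Context {R : realType}.

Lemma expR_nneseries (c : R) : 0 <= c ->
  (\sum_(0 <= n <oo) (c ^+ n / n`!%:R)%:E = (expR c)%:E)%E.
Proof.
move=> c0; rewrite expRE -EFin_lim; last first.
  rewrite /pseries/=; under eq_fun do rewrite mulrC.
  exact: is_cvg_series_exp_coeff.
apply/congr_lim/funext => n/=; rewrite /pseries/= /series/= -sumEFin//.
by under eq_bigr do rewrite mulrC.
Qed.

(** The [m]th factorial moment of a Poisson variable: the terms with [n < m]
    vanish and the others are a shifted exponential series. *)
Lemma poisson_binomial_series (c : R) m : 0 <= c ->
  (\sum_(0 <= n <oo) ('C(n, m)%:R%:E * (expR (- c) * (c ^+ n / n`!%:R))%:E) = (c ^+ m / m`!%:R)%:E)%E.
Proof.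
move=> c0.
have q0 n : 0 <= expR (- c) * (c ^+ n / n`!%:R).
  by rewrite mulr_ge0 ?expR_ge0// divr_ge0// exprn_ge0.
have F0 n : (0 <= 'C(n, m)%:R%:E * (expR (- c) * (c ^+ n / n`!%:R))%:E)%E.
  by rewrite -EFinM lee_fin mulr_ge0.
rewrite (nneseries_split 0 m)// add0n big_nat_cond big1 ?add0e; last first.
  by move=> n /andP[/andP[_ nm] _]; rewrite bin_small// mul0e.
rewrite -nneseries_addn//.
transitivity (\sum_(0 <= n <oo) ((c ^+ m / m`!%:R * expR (- c))%:E * (c ^+ n / n`!%:R)%:E))%E.
  apply: eq_eseriesr => n _; rewrite -!EFinM; congr EFin.
  have mnm : (m <= n + m)%N by rewrite leq_addl.
  have := bin_fact mnm; rewrite addnK => bf.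
  have f0 k : (k`!%:R : R) != 0 by rewrite pnatr_eq0 -lt0n fact_gt0.
  rewrite -[in (n + m)`!%:R]bf !natrM exprD.
  have b0 : ('C(n + m, m)%:R : R) != 0 by rewrite pnatr_eq0 -lt0n bin_gt0.
  by field; rewrite !f0 b0.
rewrite nneseriesZl//; last by move=> n _; rewrite lee_fin divr_ge0// exprn_ge0.
by rewrite expR_nneseries// -EFinM -(mulrA (c ^+ m / m`!%:R)) -expRD addNr expR0 mulr1.
Qed.

Lemma measurable_preimage_set1 d (T : measurableType d) (X : T -> R) x :
  measurable_fun setT X -> measurable (X @^-1` [set x]).
Proof. by move=> mX; rewrite -[X in measurable X]setTI; apply: mX. Qed.

Section one_process.
Context d (T : measurableType d) (P : probability T R) (rate : R) (N : process P).
Hypothesis rate0 : 0 < rate.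
Hypothesis poisN : poisson_process rate N.

Lemma counting_nat (M : process P) u : counting_process M -> 0 <= u ->
  {ae P, forall w, exists n : nat, M u w = n%:R}.
Proof. by move=> cM u0; apply: filterS cM => w [_ h _ _]; exact: h. Qed.

Lemma poisson_process_pmf u n : 0 <= u ->
  P (N u @^-1` [set n%:R]) = (expR (- (rate * u)) * ((rate * u) ^+ n / n`!%:R))%:E.
Proof.
case: poisN => cN _ pN u0.
have N0 : {ae P, forall w, N 0 w = 0} by apply: filterS cN => w [].
have mN v : measurable_fun setT (N v) by [].
move: u0; rewrite le_eqVlt => /predU1P[<-|u0].
  rewrite mulr0 oppr0 expR0 mul1r; case: n => [|n].
    rewrite expr0 fact0 divr1 -(@probability_setT _ _ _ P).
    apply: ae_eq_measure => //.
    by apply: filterS N0 => w /= ->.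
  rewrite expr0n mul0r; transitivity (P set0); last by rewrite measure0.
  apply: ae_eq_measure => //.
  apply: filterS N0 => w /= ->; split => // /eqP.
  by rewrite eq_sym pnatr_eq0.
have := pN 0 u n (lexx _) u0.
rewrite subr0 /poisson_pmf mulr_gt0// => pE.
rewrite [RHS](_ : _ = ((rate * u) ^+ n * n`!%:R^-1 * expR (- (rate * u)))%:E); last first.
  by congr EFin; ring.
rewrite -pE; apply: ae_eq_measure.
- exact: measurable_preimage_set1.
- by apply: measurable_preimage_set1; exact: measurable_funB.
- by apply: filterS N0 => w /= N0w; rewrite /increment N0w subr0.
Qed.

Lemma poisson_process_bin u m : 0 <= u ->
  has_integral P setT (fun w => 'C(Num.truncn (N u w), m)%:R) ((rate * u) ^+ m / m`!%:R).
Proof.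
move=> u0; apply: has_integral_ge0 => //.
  exact: (measurable_truncn_comp (fun n => 'C(n, m)%:R)).
rewrite (@integral_nat_valued _ _ _ P (N u) (fun n => 'C(n, m)%:R))//; last first.
  by case: poisN => cN _ _; exact: counting_nat.
under eq_eseriesr do rewrite poisson_process_pmf//.
by rewrite poisson_binomial_series// mulr_ge0// ltW.
Qed.

(** Expand [q ^ N] as a binomial series in [q - 1]; the factorial moments
    [(rate * u) ^ m / m!] of [N] rebuild the exponential of
    [rate * u * (q - 1)]. *)
Lemma poisson_process_coef (q : {poly R}) r u i : q`_0 = 1 -> 0 <= u -> (i <= r)%N ->
  has_integral P setT (fun w => (q ^+ Num.truncn (N u w))`_i)
    (exp_trunc r ((rate * u) *: (q - 1)))`_i.
Proof.
move=> q1 u0 ir.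
have p0 : (q - 1)`_0 = 0 by rewrite coefB coef1 q1 subrr.
apply: (eq_has_integral (f := fun w => \sum_(m < r.+1)
    ((q - 1) ^+ m)`_i * 'C(Num.truncn (N u w), m)%:R)).
  have qE : q = 1 + (q - 1) by rewrite addrC subrK.
  move=> w; rewrite [in RHS]qE (coef_expr1D _ p0 ir).
  by apply: eq_bigr => m _; rewrite mulrC.
rewrite coef_exp_trunc.
rewrite (eq_bigr (fun m : 'I_r.+1 => ((q - 1) ^+ m)`_i * ((rate * u) ^+ m / m`!%:R))); last first.
  by move=> m _; rewrite exprZn coefZ; ring.
by apply: has_integral_sum => // m; apply: has_integralZ => //; exact: poisson_process_bin.
Qed.
End one_process.

(** Nonnegative coefficients make all means of products legitimate without any
    integrability discussion. *)
Definition nneg_coef (q : {poly R}) := forall i, 0 <= q`_i.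

Lemma nneg_coefM p q : nneg_coef p -> nneg_coef q -> nneg_coef (p * q).
Proof. by move=> p0 q0 i; rewrite coefM sumr_ge0// => j _; rewrite mulr_ge0. Qed.

Lemma nneg_coefX p n : nneg_coef p -> nneg_coef (p ^+ n).
Proof.
move=> p0; elim: n => [|n IH]; last by rewrite exprS; exact: nneg_coefM.
by move=> i; rewrite expr0 coef1.
Qed.

(** [g ^ M] is the product of the [(g ^ j) ^ N_j], and a coefficient of a product is a
    finite sum of products of coefficients, to which independence applies. *)
Lemma GCP_coef k (lambda : 'I_k -> R) d (T : measurableType d) (P : probability T R)
    (M : process P) (g : {poly R}) r u i :
  (forall j, 0 < lambda j) -> GCP lambda M -> nneg_coef g -> g`_0 = 1 ->
  0 <= u -> (i <= r)%N ->
  has_integral P setT (fun w => (g ^+ Num.truncn (M u w))`_i)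
    (exp_trunc r (u *: \sum_(j < k) lambda j *: (g ^+ j.+1 - 1)))`_i.
Proof.
move=> l0 [cM [d' [T' [P' [N [pN indN law]]]]]] g0 g1 u0 ir.
have q1 n : (g ^+ n)`_0 = 1 by rewrite coef0_expr g1 expr1n.
apply: has_integral_ge0 => //.
- exact: (measurable_truncn_comp (fun n => (g ^+ n)`_i)).
- by move=> w _; exact: nneg_coefX.
pose X' w := \sum_(j < k) j.+1%:R * N j u w.
have mX' : measurable_fun setT X'.
  by apply: measurable_sum => j; apply: measurable_funM.
rewrite (@law_integral _ _ _ P _ _ P' (M u) X' (fun x => (g ^+ Num.truncn x)`_i))//; first last.
- move=> A mA; have := law 1%N (fun=> u) (fun=> A) (fun=> u0) (fun=> mA).
  by rewrite !bigcap_const//; exists ord0.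
- by move=> x; exact: nneg_coefX.
- exact: (measurable_truncn_comp (f := id) (fun n => (g ^+ n)`_i)).
pose V := fun w => \sum_(m : {ffun 'I_k -> 'I_r.+1} | (\sum_(l < k) m l == i)%N)
     \prod_(l < k) ((g ^+ l.+1) ^+ Num.truncn (N l u w))`_(m l).
have VE w : (\prod_(l < k) (g ^+ l.+1) ^+ Num.truncn (N l u w))`_i = V w by exact: coef_prod_ffun.
have hV : has_integral P' setT V
    (exp_trunc r (u *: \sum_(j < k) lambda j *: (g ^+ j.+1 - 1)))`_i.
  rewrite scaler_sumr (@exp_trunc_sum _ r _ _ (fun j => u *: (lambda j *: (g ^+ j.+1 - 1))))//; last first.
    by move=> j; rewrite !coefZ coefB coef1 q1 subrr !mulr0.
  rewrite (coef_prod_ffun _ ir).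
  rewrite /V !big_mkcond/=.
  apply: (eq_has_integral (f := fun w => \sum_(m : {ffun 'I_k -> 'I_r.+1})
     if (\sum_(l < k) m l == i)%N then
     \prod_(l < k) ((g ^+ l.+1) ^+ Num.truncn (N l u w))`_(m l) else 0)).
    by move=> w; rewrite [RHS]big_mkcond.
  apply: has_integral_sum => // m; case: ifPn => _; last exact: has_integral0.
  have hj (j : 'I_k) : has_integral P' setT (fun w => ((g ^+ j.+1) ^+ Num.truncn (N j u w))`_(m j))
      (exp_trunc r (u *: (lambda j *: (g ^+ j.+1 - 1))))`_(m j).
    rewrite scalerA [u * _]mulrC.
    by apply: poisson_process_coef => //; rewrite -ltnS.
  have cge0 (j : 'I_k) x : 0 <= ((g ^+ j.+1) ^+ Num.truncn (x : R))`_(m j).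
    by apply: nneg_coefX; exact: nneg_coefX.
  apply: has_integral_ge0 => //.
  - apply: measurable_prod => j _.
    exact: (measurable_truncn_comp (fun n => ((g ^+ j.+1) ^+ n)`_(m j))).
  - by move=> w _; exact: prodr_ge0.
  apply: (@indep_prod_integral R _ _ P' k (fun j => N j u)
    (fun j x => ((g ^+ j.+1) ^+ Num.truncn x)`_(m j))
    (fun j => (exp_trunc r (u *: (lambda j *: (g ^+ j.+1 - 1))))`_(m j)) k) => //.
  - move=> A mA; apply: (indN (fun j => N j u @^-1` A j)) => j.
    by apply: sub_sigma_algebra; exists u, (A j).
  - move=> j.
    exact: (measurable_truncn_comp (f := id) (fun n => ((g ^+ j.+1) ^+ n)`_(m j))).
  - by move=> j; have [_] := hj j.
  - by move=> j; rewrite leqNgt ltn_ord.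
have [iV <-] := hV.
apply: ae_eq_integral => //.
- apply/measurable_EFinP; exact: (measurable_truncn_comp (fun n => (g ^+ n)`_i)).
- exact: measurable_int iV.
have Nnat : {ae P', forall w, forall j : 'I_k, exists n : nat, N j u w = n%:R}.
  by apply: filter_forall => j; have [cN _ _] := pN j; exact: counting_nat.
apply: filterS Nnat => w Nw _; congr EFin; rewrite -VE; congr ((polyseq _)`_i).
have [n nE] : exists n : 'I_k -> nat, forall j, N j u w = (n j)%:R.
  by have /choice[n nE] := Nw; exists n.
rewrite /X' (eq_bigr (fun j : 'I_k => (j.+1 * n j)%:R)); last by move=> j _; rewrite nE natrM.
rewrite -natr_sum natrK.
under [RHS]eq_bigr => l _ do rewrite nE natrK -exprM.
by rewrite prodrXr.
Qed.

Lemma coef_compNX (p : {poly R}) i : (p \Po (- 'X))`_i = (-1) ^+ i * p`_i.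
Proof.
elim/poly_ind: p i => [|p c IH] i; first by rewrite comp_poly0 !coef0 mulr0.
rewrite comp_polyD comp_polyM comp_polyX comp_polyC !coefD !coefC mulrN coefN !coefMX.
case: i => [|i] /=; first by rewrite oppr0 !add0r mul1r.
by rewrite IH !addr0 exprS mulN1r mulNr.
Qed.

Lemma exp_trunc_comp r (a q : {poly R}) : exp_trunc r a \Po q = exp_trunc r (a \Po q).
Proof.
rewrite /exp_trunc raddf_sum; apply: eq_bigr => m _ /=.
by rewrite comp_polyZ; congr (_ *: _); exact: (rmorphXn (comp_poly q)).
Qed.

Section skellam.
Variables (k : nat) (lambda mu : 'I_k -> R).

(** The Laplace exponent of the process in the variable [x] where
    [exp theta = 1 + x]: a jump of size [j] contributes [(1 + x) ^ j - 1], a jump of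
    size [- j] contributes [(1 + x) ^ (- j) - 1]. *)
Definition jump_series r : {poly R} :=
  \sum_(j < k) lambda j *: (('X + 1) ^+ j.+1 - 1) +
  ((\sum_(j < k) mu j *: (geom_trunc R r ^+ j.+1 - 1)) \Po (- 'X)).

Definition skellam_moment r u : R := r`!%:R * (exp_trunc r (u *: jump_series r))`_r.

(** By the Chu-Vandermonde identity the falling factorial of [M1 - M2] is a signed
    sum of products of coefficients of [(1 + X) ^ M1] and of [(1 - X) ^ (- M2)]; the
    sign [(-1) ^ i] amounts to replacing [X] by [- X] in the second factor. *)
Lemma GSP_factorial_moment d (T : measurableType d) (P : probability T R) (S : process P) r u :
  (forall j, 0 < lambda j) -> (forall j, 0 < mu j) ->
  GSP lambda mu S -> 0 <= u ->
  has_integral P setT (fun w => falling (S u w) r) (skellam_moment r u).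
Proof.
move=> l0 m0 [M1 [M2 [G1 G2 ind SE]]] u0.
pose g1 : {poly R} := 'X + 1; pose g2 : {poly R} := geom_trunc R r.
pose a1 : {poly R} := u *: \sum_(j < k) lambda j *: (g1 ^+ j.+1 - 1).
pose a2 : {poly R} := u *: \sum_(j < k) mu j *: (g2 ^+ j.+1 - 1).
have g10 : nneg_coef g1.
  by move=> i; rewrite coefD coefX coef1 addr_ge0.
have g20 : nneg_coef g2 by move=> i; rewrite coef_poly; case: ifP.
have g11 : g1`_0 = 1 by rewrite coefD coefX coef1 add0r.
have g21 : g2`_0 = 1 by rewrite coef_poly.
have a10 : a1`_0 = 0.
  rewrite /a1 coefZ coef_sum big1 ?mulr0// => j _.
  by rewrite coefZ coefB coef1 coef0_expr g11 expr1n subrr mulr0.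
have a20 : a2`_0 = 0.
  rewrite /a2 coefZ coef_sum big1 ?mulr0// => j _.
  by rewrite coefZ coefB coef1 coef0_expr g21 expr1n subrr mulr0.
have h1 i : (i <= r)%N -> has_integral P setT (fun w => (g1 ^+ Num.truncn (M1 u w))`_i) (exp_trunc r a1)`_i.
  by move=> ir; exact: GCP_coef.
have h2 i : (i <= r)%N -> has_integral P setT (fun w => (g2 ^+ Num.truncn (M2 u w))`_i) (exp_trunc r a2)`_i.
  by move=> ir; exact: GCP_coef.
have h12 i j : (i <= r)%N -> (j <= r)%N -> has_integral P setT
    (fun w => (g1 ^+ Num.truncn (M1 u w))`_i * (g2 ^+ Num.truncn (M2 u w))`_j)
    ((exp_trunc r a1)`_i * (exp_trunc r a2)`_j).
  move=> ir jr.
  have mg l (gg : {poly R}) : measurable_fun setT (fun x : R => (gg ^+ Num.truncn x)`_l).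
    exact: (measurable_truncn_comp (f := id) (fun n => (gg ^+ n)`_l)).
  have c0 : 0 <= (exp_trunc r a1)`_i.
    rewrite -lee_fin; have [_ <-] := h1 i ir.
    by apply: integral_ge0 => w _; rewrite lee_fin; exact: nneg_coefX.
  have mW : measurable_fun setT (fun w => (g1 ^+ Num.truncn (M1 u w))`_i).
    exact: (measurable_truncn_comp (fun n => (g1 ^+ n)`_i)).
  apply: has_integral_ge0 => //.
  - apply: measurable_funM => //; exact: (measurable_truncn_comp (fun n => (g2 ^+ n)`_j)).
  - by move=> w _; rewrite mulr_ge0//; exact: nneg_coefX.
  rewrite (@indep_integral _ _ _ P (M2 u) _ (fun x => (g2 ^+ Num.truncn x)`_j) (exp_trunc r a1)`_i)//.
  - by have [_ ->] := h2 j jr; rewrite EFinM.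
  - by move=> w; exact: nneg_coefX.
  - by move=> w; exact: nneg_coefX.
  move=> A mA.
  have mA2 : measurable (M2 u @^-1` A) by rewrite -[X in measurable X]setTI; exact: measurable_funPT.
  under eq_integral do rewrite mulrC.
  rewrite (@indep_integral _ _ _ P (M1 u) (fun w => \1_A (M2 u w))
     (fun x => (g1 ^+ Num.truncn x)`_i) (fine (P (M2 u @^-1` A))))//.
  - by have [_ ->] := h1 i ir; rewrite fineK ?fin_num_measure// muleC.
  - by rewrite fine_ge0.
  - by apply: (measurableT_comp _ (measurable_funPT (M2 u))); exact: measurable_indic.
  - by move=> w; exact: nneg_coefX.
  move=> B mB.
  transitivity (\int[P]_w (\1_(M2 u @^-1` A `&` M1 u @^-1` B) w)%:E)%E.
    by apply: eq_integral => w _; rewrite indicI.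
  have mB1 : measurable (M1 u @^-1` B) by rewrite -[X in measurable X]setTI; exact: measurable_funPT.
  rewrite integral_indic// ?setIT; last exact: measurableI.
  transitivity (P (M1 u @^-1` B `&` M2 u @^-1` A)); first by rewrite setIC.
  rewrite ind.
  - by rewrite muleC fineK// fin_num_measure.
  - by apply: sub_sigma_algebra; exists u, B.
  - by apply: sub_sigma_algebra; exists u, A.
pose F w := \sum_(i < r.+1) (r`!%:R * (-1) ^+ (r - i)) *
   ((g1 ^+ Num.truncn (M1 u w))`_i * (g2 ^+ Num.truncn (M2 u w))`_(r - i)).
have hF : has_integral P setT F (skellam_moment r u).
  have -> : skellam_moment r u = \sum_(i < r.+1) (r`!%:R * (-1) ^+ (r - i)) *
     ((exp_trunc r a1)`_i * (exp_trunc r a2)`_(r - i)).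
    rewrite /skellam_moment.
    have -> : u *: jump_series r = a1 + (a2 \Po (- 'X)).
      by rewrite /jump_series scalerDr -comp_polyZ.
    rewrite exp_truncD//; last by rewrite coef_compNX a20 mulr0.
    rewrite coefM mulr_sumr; apply: eq_bigr => i _.
    by rewrite -exp_trunc_comp coef_compNX; ring.
  apply: has_integral_sum => // i; apply: has_integralZ => //; apply: h12.
    by rewrite -ltnS.
  exact: leq_subr.
apply: (has_integral_ae _ _ hF).
  have -> : (fun w => falling (S u w) r) = (fun w => \prod_(i <- index_enum 'I_r) (S u w - i%:R)) by [].
  by apply: measurable_prod => i _; exact: measurable_funB.
have [[c1 _] [c2 _]] := (G1, G2).
apply: filterS2 (counting_nat c1 u0) (counting_nat c2 u0) => w [n1 E1] [n2 E2].
rewrite /F SE// E1 E2 !natrK fallingD; apply: eq_bigr => i _.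
have ir : (i <= r)%N by rewrite -ltnS.
rewrite falling_nat falling_natN coef_X1X -(@coef_geomX _ r) ?leq_subr//.
rewrite -bin_ffact natrM -(bin_fact ir) !natrM.
by ring.
Qed.

Lemma coef_jump_seriesX n r : (0 < r)%N ->
  (jump_series r ^+ n)`_r =
    \sum_(m : {ffun 'I_n -> 'I_r.+1} |
             (\sum_(l < n) m l == r)%N && [forall l, (0 < m l)%N])
        \prod_(l < n)
          ((m l)`!%:R^-1 *
           \sum_(j < k)
             ((j.+1 ^_ (m l))%:R * lambda j
              + (-1) ^+ m l * (rising_factorial j.+1 (m l))%:R * mu j)).
Proof.
move=> r0.
have cf j M : (j <= r)%N -> (geom_trunc R r ^+ M)`_j = j`!%:R^-1 * (rising_factorial M j)%:R.
  move=> jr; rewrite -(@coef_geomX _ r)// mulKf// pnatr_eq0 -lt0n fact_gt0//.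
have b0 : (jump_series r)`_0 = 0.
  rewrite /jump_series coefD coef_compNX !coef_sum big1 => [|j _]; last first.
    by rewrite coefZ coefB coef1 coef0_expr coefD coefX coef1 add0r expr1n subrr mulr0.
  rewrite add0r big1 ?mulr0// => j _.
  by rewrite coefZ coefB coef1 coef0_expr coef_poly expr1n subrr mulr0.
have bE (j : nat) : (0 < j)%N -> (j <= r)%N -> (jump_series r)`_j = j`!%:R^-1 *
   \sum_(i < k) ((i.+1 ^_ j)%:R * lambda i
              + (-1) ^+ j * (rising_factorial i.+1 j)%:R * mu i).
  move=> j0 jr; rewrite /jump_series coefD coef_compNX !coef_sum mulr_sumr -big_split mulr_sumr /=.
  apply: eq_bigr => i _.
  rewrite !coefZ !coefB coef1 [(j == 0)%N]gtn_eqF// !subr0 cf// coef_X1X.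
  rewrite -bin_ffact natrM.
  have f0 : (j`!%:R : R) != 0 by rewrite pnatr_eq0 -lt0n fact_gt0.
  by field.
rewrite -[in LHS](card_ord n) -prodr_const coef_prod_pos//.
apply: eq_bigr => m /andP[_ /forallP mpos]; apply: eq_bigr => l _.
by rewrite bE// -ltnS.
Qed.

Definition skellam_poly r : {poly R} :=
  \sum_(n < r.+1) (r`!%:R / n`!%:R * (jump_series r ^+ n)`_r) *: 'X^n.

Lemma horner_skellam_poly r u : (skellam_poly r).[u] = skellam_moment r u.
Proof.
rewrite /skellam_moment coef_exp_trunc horner_sum mulr_sumr; apply: eq_bigr => n _.
by rewrite hornerZ hornerXn exprZn coefZ; ring.
Qed.

End skellam.
End poisson_moments.

(** * Moments at an independent random time *)

Section compose.
Context {R : realType} d (T : measurableType d) (P : probability T R).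
Implicit Types p q : {poly R}.

Lemma measurable_random_index (K : T -> nat) (F : nat -> T -> R) :
  measurable_fun setT K -> (forall n, measurable_fun setT (F n)) ->
  measurable_fun setT (fun w => F (K w) w).
Proof.
move=> mK mF _ B mB; rewrite setTI.
rewrite (_ : _ @^-1` B = \bigcup_n (K @^-1` [set n] `&` F n @^-1` B)).
  apply: bigcup_measurable => n _; apply: measurableI.
    by rewrite -[X in measurable X]setTI; exact: mK.
  by rewrite -[X in measurable X]setTI; exact: mF.
apply/seteqP; split => [w Bw|w [n _ [<-]]//].
by exists (K w).
Qed.

Lemma integral_random_index (K : T -> nat) (F : nat -> T -> R) :
  measurable_fun setT K -> (forall n, measurable_fun setT (F n)) ->
  (forall n w, 0 <= F n w) ->
  (\int[P]_w (F (K w) w)%:E =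
   \sum_(0 <= n <oo) \int[P]_w (\1_(K @^-1` [set n]) w * F n w)%:E)%E.
Proof.
move=> mK mF F0.
have mKn n : measurable (K @^-1` [set n]) by rewrite -[X in measurable X]setTI; exact: mK.
have m1F n : measurable_fun setT (fun w => \1_(K @^-1` [set n]) w * F n w).
  by apply: measurable_funM => //; exact: measurable_indic.
rewrite -integral_nneseries//; last 2 first.
- by move=> n; exact/measurable_EFinP.
- by move=> n w _; rewrite lee_fin mulr_ge0.
apply: eq_integral => w _.
rewrite (@nneseriesD1 _ _ (K w))//; last by move=> m _; rewrite lee_fin mulr_ge0.
rewrite indicE mem_set// mul1r eseries0 ?adde0// => m _ mK'.
by rewrite indicE memNset ?mul0r//= => Km; move: mK'; rewrite Km eqxx.
Qed.

Definition poly_mean (S : R -> T -> R) p q :=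
  forall u, 0 <= u -> has_integral P setT (fun w => p.[S u w]) q.[u].

Lemma poly_mean_comb S p1 q1 p2 q2 a b : poly_mean S p1 q1 -> poly_mean S p2 q2 ->
  poly_mean S (a *: p1 + b *: p2) (a *: q1 + b *: q2).
Proof.
move=> h1 h2 u u0.
apply: (eq_has_integral (f := fun w => a * p1.[S u w] + b * p2.[S u w])).
  by move=> w; rewrite hornerD !hornerZ.
rewrite hornerD !hornerZ; apply: has_integralD => //; apply: has_integralZ => //.
  exact: h1.
exact: h2.
Qed.

Definition falling_poly r : {poly R} := \prod_(i < r) ('X - (i%:R)%:P).

Lemma horner_falling_poly r x : (falling_poly r).[x] = falling x r.
Proof.
rewrite /falling_poly /falling horner_prod; apply: eq_bigr => i _.
by rewrite hornerXsubC.
Qed.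

Lemma falling_polyS r : falling_poly r.+1 = falling_poly r * ('X - (r%:R)%:P).
Proof. by rewrite /falling_poly big_ord_recr. Qed.

(** Multiplying a falling factorial by [x - s] is [(x) _ r.+1] plus a multiple of
    [(x) _ r], so products stay in the span of falling factorials. Only the
    existence of some polynomial matters. *)
Lemma poly_mean_falling_mul S (F : nat -> {poly R}) : (forall r, poly_mean S (falling_poly r) (F r)) ->
  forall s r, exists q, poly_mean S (falling_poly r * falling_poly s) q.
Proof.
move=> hF; elim=> [|s IH] r.
  by exists (F r); rewrite {2}/falling_poly big_ord0 mulr1.
have [q1 h1] := IH r.+1; have [q2 h2] := IH r.
exists (1 *: q1 + (r%:R - s%:R) *: q2).
have -> : falling_poly r * falling_poly s.+1 =
    1 *: (falling_poly r.+1 * falling_poly s) + (r%:R - s%:R) *: (falling_poly r * falling_poly s).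
  rewrite !falling_polyS -!mul_polyC polyCB; ring.
exact: poly_mean_comb.
Qed.

Lemma has_integral_poly (V : T -> R) (v : nat -> R) p :
  (forall n, has_integral P setT (fun w => V w ^+ n) (v n)) ->
  has_integral P setT (fun w => p.[V w]) (\sum_(i < size p) p`_i * v i).
Proof.
move=> hv; apply: (eq_has_integral (f := fun w => \sum_(i < size p) p`_i * V w ^+ i)).
  by move=> w; rewrite horner_coef.
by apply: has_integral_sum => // i; exact: has_integralZ.
Qed.

(** Times are discretized from above, because the paths are only right
    continuous. *)
Definition grid (N n : nat) : R := n.+1%:R / N.+1%:R.
Definition grid_index (N : nat) (x : R) : nat := Num.truncn (N.+1%:R * x).

Lemma grid_ge0 N n : 0 <= grid N n.
Proof. by rewrite divr_ge0. Qed.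

Lemma grid_gt N x : 0 <= x -> x < grid N (grid_index N x).
Proof. by move=> x0; rewrite ltr_pdivlMr// mulrC truncnS_gt. Qed.

Lemma grid_le N x : 0 <= x -> grid N (grid_index N x) <= x + N.+1%:R^-1.
Proof.
move=> x0; rewrite ler_pdivrMr// mulrDl mulVf// -natr1 lerD2r mulrC.
by rewrite truncn_le mulr_ge0.
Qed.

Lemma grid_cvg x : 0 <= x -> grid N (grid_index N x) @[N --> \oo] --> x.
Proof.
move=> x0.
have c1 : (x + N.+1%:R^-1 : R) @[N --> \oo] --> x.
  rewrite -[X in _ --> X]addr0; apply: cvgD; first exact: cvg_cst.
  exact: cvg_harmonic.
apply: (squeeze_cvgr _ (cvg_cst x) c1).
by near=> N; rewrite ltW ?grid_gt//= grid_le.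
Unshelve. all: by end_near. Qed.

Variables (S Y : process P) (t : R).
Hypothesis t0 : 0 <= t.
Hypothesis Yt0 : forall w, 0 <= Y t w.
Hypothesis indSY : independent_processes S Y.
Hypothesis Sright : {ae P, forall w, forall u : nat -> R, (forall n, Y t w < u n) ->
  u n @[n --> \oo] --> Y t w -> S (u n) w @[n --> \oo] --> S (Y t w) w}.
Variable X : T -> R.
Hypothesis mX : measurable_fun setT X.
Hypothesis XE : forall w, X w = S (Y t w) w.
Variable v : nat -> R.
Hypothesis Ymoment : forall n, has_integral P setT (fun w => Y t w ^+ n) (v n).

Let K N w := grid_index N (Y t w).

Let mK N : measurable_fun setT (K N).
Proof.
apply: (measurableT_comp measurable_truncn) => //.
exact: measurable_funM.
Qed.

Let mSK N : measurable_fun setT (fun w => S (grid N (K N w)) w).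
Proof. exact: (measurable_random_index (F := fun n => S (grid N n))). Qed.

(** On each event where the discretized time takes a given value, independence
    factors the mean. *)
Let mean_grid p q N : poly_mean S p q -> (forall x, 0 <= p.[x]) ->
  (\int[P]_w (p.[S (grid N (K N w)) w])%:E = \int[P]_w (q.[grid N (K N w)])%:E)%E.
Proof.
move=> pq p0.
have q0 n : 0 <= q.[grid N n].
  rewrite -lee_fin -(has_integralE (pq _ (grid_ge0 N n))).
  by apply: integral_ge0 => w _; rewrite lee_fin.
rewrite (@integral_random_index (K N) (fun n w => p.[S (grid N n) w]))//; last first.
  by move=> n; apply: measurableT_comp => //; exact: measurable_poly.
rewrite (@integral_random_index (K N) (fun n w => q.[grid N n]))//.
apply: eq_eseriesr => n _.
have mB : measurable [set y : R | grid_index N y = n].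
  have : measurable_fun setT (grid_index N).
    by apply: (measurableT_comp measurable_truncn) => //; exact: measurable_funM.
  by move=> /(_ measurableT [set n]); rewrite setTI; apply.
have mKn : measurable (K N @^-1` [set n]) by rewrite -[X in measurable X]setTI; exact: mK.
have intK : (\int[P]_w (\1_(K N @^-1` [set n]) w : R)%:E = P (K N @^-1` [set n]))%E.
  by rewrite integral_indic// setIT.
rewrite (@indep_integral _ _ _ P (S (grid N n)) (\1_(K N @^-1` [set n])) (horner p)
   (fine (P (K N @^-1` [set n]))))//.
- rewrite (has_integralE (pq _ (grid_ge0 N n))).
  under [RHS]eq_integral do rewrite mulrC.
  by rewrite ge0_integralZ_EFin// intK fineK ?fin_num_measure// muleC.
- by rewrite fine_ge0.
- exact: measurable_poly.
move=> A mA.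
transitivity (\int[P]_w (\1_(K N @^-1` [set n] `&` S (grid N n) @^-1` A) w)%:E)%E.
  by apply: eq_integral => w _; rewrite indicI.
have mSA : measurable (S (grid N n) @^-1` A) by rewrite -[X in measurable X]setTI; exact: measurable_funPT.
rewrite integral_indic//; last exact: measurableI.
transitivity (P (S (grid N n) @^-1` A `&` K N @^-1` [set n])); first by rewrite setIT setIC.
rewrite indSY.
- by rewrite muleC fineK// fin_num_measure.
- by apply: sub_sigma_algebra; exists (grid N n), A; split => //; exact: grid_ge0.
- by apply: sub_sigma_algebra; exists t, [set y : R | grid_index N y = n].
Qed.

Let mean_q q := \sum_(i < size q) q`_i * v i.

Let grid_mean_cvg q :
  (\int[P]_w (q.[grid N (K N w)])%:E @[N --> \oo] --> (mean_q q)%:E)%E.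
Proof.
rewrite /mean_q -(has_integralE (has_integral_poly q Ymoment)).
pose qa : {poly R} := \poly_(i < size q) `|q`_i|.
have [ga _] : has_integral P setT (fun w => (qa \Po ('X + 1)).[Y t w])
   (\sum_(i < size (qa \Po ('X + 1))) (qa \Po ('X + 1))`_i * v i) by exact: has_integral_poly.
apply: (@dominated_cvg _ _ _ P setT measurableT (fun N w => (q.[grid N (K N w)])%:E)
   (fun w => (q.[Y t w])%:E) (EFin \o (fun w => (qa \Po ('X + 1)).[Y t w]))) => //.
- move=> N; apply/measurable_EFinP.
  exact: (measurable_random_index (F := fun n _ => q.[grid N n])).
- move=> w _; apply/cvg_EFin; first exact: nearW.
  apply: (@continuous_cvg _ R R _ _ _ (horner q)); last exact: grid_cvg.
  exact: continuous_horner.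
- move=> N w _; rewrite /= lee_fin.
  have g0 := grid_ge0 N (K N w).
  have gY : grid N (K N w) <= Y t w + 1.
    rewrite (le_trans (grid_le N (Yt0 w)))// lerD2l invf_le1// ler1n//.
  rewrite horner_comp !hornerE {1}horner_coef (le_trans (ler_norm_sum _ _ _))//.
  rewrite horner_poly ler_sum// => i _.
  by rewrite normrM ler_wpM2l// normrX (ger0_norm g0) lerXn2r// ?nnegrE// (le_trans g0).
Qed.

(** Fatou's lemma along the discretized times, which converge to [Y t] from the
    right. *)
Lemma compose_le p q : poly_mean S p q -> (forall x, 0 <= p.[x]) ->
  (\int[P]_w (p.[X w])%:E <= (mean_q q)%:E)%E.
Proof.
move=> pq p0.
have mf N : measurable_fun setT (fun w => (p.[S (grid N (K N w)) w])%:E).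
  by apply/measurable_EFinP; apply: (measurableT_comp _ (mSK N)); exact: measurable_poly.
have cv : {ae P, forall w, p.[S (grid N (K N w)) w] @[N --> \oo] --> p.[X w]}.
  apply: filterS Sright => w Sw; rewrite XE.
  apply: (@continuous_cvg _ R R _ _ _ (horner p)); first exact: continuous_horner.
  apply: (Sw (fun N => grid N (K N w))).
    by move=> N; exact: grid_gt.
  exact: grid_cvg.
have ge0 N w : setT w -> (0 <= (p.[S (grid N (K N w)) w])%:E)%E by move=> _; rewrite lee_fin.
have F := fatou P measurableT mf ge0.
have mlim : measurable_fun setT (fun w => limn_einf (fun N => (p.[S (grid N (K N w)) w])%:E)).
  apply: (@eq_measurable_fun _ _ _ _ _
    (fun w => - limn_esup (fun N => - (p.[S (grid N (K N w)) w])%:E))%E).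
    by move=> w _; rewrite (limn_esupN (fun N => (p.[S (grid N (K N w)) w])%:E)) oppeK.
  apply: measurableT_comp => //; apply: measurable_fun_limn_esup => N.
  by apply: measurableT_comp => //; exact: mf.
have limE : (limn_einf (fun N => \int[P]_w (p.[S (grid N (K N w)) w])%:E) = (mean_q q)%:E)%E.
  under eq_fun do rewrite (mean_grid _ pq p0).
  by have [-> _] := cvg_limn_einf_sup (grid_mean_cvg (q := q)).
rewrite -limE; apply: le_trans F.
rewrite le_eqVlt; apply/orP; left; apply/eqP; apply: ae_eq_integral => //.
  by apply/measurable_EFinP; apply: (measurableT_comp _ mX); exact: measurable_poly.
apply: filterS cv => w cw _; apply/esym.
have : ((p.[S (grid N (K N w)) w])%:E @[N --> \oo] --> (p.[X w])%:E)%E.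
  by apply/cvg_EFin; first exact: nearW.
by move=> /cvg_limn_einf_sup[-> _].
Qed.

Let mean_q_comb q1 q2 a b : mean_q (a *: q1 + b *: q2) = a * mean_q q1 + b * mean_q q2.
Proof.
have h q : has_integral P setT (fun w => q.[Y t w]) (mean_q q) by exact: has_integral_poly.
apply: (has_integral_unique (h _)).
apply: (eq_has_integral (f := fun w => a * q1.[Y t w] + b * q2.[Y t w])).
  by move=> w; rewrite hornerD !hornerZ.
by apply: has_integralD => //; apply: has_integralZ.
Qed.

Let poly_mean1 : poly_mean S 1 1.
Proof.
move=> u u0; apply: (eq_has_integral (f := fun=> 1)); first by move=> w; rewrite hornerC.
by rewrite hornerC; exact: has_integral1.
Qed.

(** Apply [compose_le] to the nonnegative polynomials
    [e * f ^ 2 + s * f + 1 / (4 * e)], the square of [f + s / (2 * e)] up to the factor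
    [e], with [s = 1] and [s = -1]. The constants cancel and the terms in [f ^ 2] are
    of size [e], so equality follows from two one-sided bounds, without
    dominating the process over the random time. *)
Theorem compose_moment f qf q2 : poly_mean S f qf -> poly_mean S (f * f) q2 ->
  has_integral P setT (fun w => f.[X w]) (\sum_(i < size qf) qf`_i * v i).
Proof.
move=> hf hff; rewrite -/(mean_q qf).
have mp (p : {poly R}) : measurable_fun setT (fun w => p.[X w]).
  by apply: (measurableT_comp _ mX); exact: measurable_poly.
have le2 : (\int[P]_w ((f * f).[X w])%:E <= (mean_q q2)%:E)%E.
  by apply: compose_le => // x; rewrite hornerM -expr2 sqr_ge0.
have i2ge0 : (0 <= \int[P]_w ((f * f).[X w])%:E)%E.
  by apply: integral_ge0 => w _; rewrite lee_fin hornerM -expr2 sqr_ge0.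
pose A := fine (\int[P]_w ((f * f).[X w])%:E)%E.
have hA : has_integral P setT (fun w => (f * f).[X w]) A.
  apply: has_integral_ge0 => //.
    by move=> w _; rewrite hornerM -expr2 sqr_ge0.
  by rewrite fineK// ge0_fin_numE// (le_lt_trans le2)// ltry.
have h1 := has_integral1 P.
have intf : P.-integrable setT (EFin \o (fun w => f.[X w])).
  have [i _] := has_integralD measurableT hA h1.
  apply: (le_integrable _ _ _ i) => //; first exact/measurable_EFinP.
  move=> w _; rewrite /= lee_fin hornerM -expr2.
  rewrite [leRHS]ger0_norm ?addr_ge0 ?sqr_ge0//.
  have := sqr_ge0 (`|f.[X w]| - 1); rewrite sqrrB1 real_normK ?num_real//.
  have := normr_ge0 f.[X w]; lra.
pose B := fine (\int[P]_w (f.[X w])%:E)%E.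
have hB : has_integral P setT (fun w => f.[X w]) B.
  by split => //; rewrite fineK// integrable_fin_num.
suff -> : mean_q qf = B by [].
have key s e : s ^+ 2 = 1 -> 0 < e -> s * (B - mean_q qf) <= e * (mean_q q2 - A).
  move=> s1 e0.
  pose h := e *: (f * f) + 1 *: (s *: f + (4 * e)^-1 *: 1).
  have hh : poly_mean S h (e *: q2 + 1 *: (s *: qf + (4 * e)^-1 *: 1)).
    by apply: poly_mean_comb => //; exact: poly_mean_comb.
  have hE x : h.[x] = e * (f * f).[x] + (s * f.[x] + (4 * e)^-1 * 1).
    by rewrite /h !(hornerD, hornerZ, hornerC) mul1r.
  have h0 x : 0 <= h.[x].
    rewrite hE hornerM.
    have -> : e * (f.[x] * f.[x]) + (s * f.[x] + (4 * e)^-1 * 1) = e * (f.[x] + s / (2 * e)) ^+ 2.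
      have -> : (4 * e)^-1 * 1 = s ^+ 2 * (4 * e)^-1 by rewrite s1 mulr1 mul1r.
      by field; rewrite gt_eqF.
    by rewrite mulr_ge0 ?sqr_ge0// ltW.
  have := compose_le hh h0.
  have [_ ->] : has_integral P setT (fun w => h.[X w]) (e * A + (s * B + (4 * e)^-1 * 1)).
    apply: (eq_has_integral (f := fun w => e * (f * f).[X w] + (s * f.[X w] + (4 * e)^-1 * 1))).
      by move=> w; rewrite hE.
    apply: has_integralD => //; first exact: has_integralZ.
    by apply: has_integralD => //; exact: has_integralZ.
  rewrite lee_fin !mean_q_comb mul1r.
  set c := (4 * e)^-1.
  have -> : mean_q 1 = 1.
    have hm : has_integral P setT (fun w => (1 : {poly R}).[Y t w]) (mean_q 1) by exact: has_integral_poly.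
    apply: (has_integral_unique hm).
    by apply: (eq_has_integral _ h1) => w; rewrite hornerC.
  lra.
have D0 : `|B - mean_q qf| = 0.
  apply/eqP; rewrite eq_le normr_ge0 andbT; apply/ler_addgt0Pr => e e0; rewrite add0r.
  pose C := `|mean_q q2 - A| + 1.
  have C0 : 0 < C by rewrite ltr_wpDl.
  have e'0 : 0 < e / C by rewrite divr_gt0.
  have eC : e / C * (mean_q q2 - A) <= e.
    rewrite -[leRHS]mulr1 -mulrA ler_wpM2l ?(ltW e0)//.
    rewrite mulrC ler_pdivrMr// mul1r (le_trans (ler_norm _))// /C lerDl//.
  rewrite ler_norml; apply/andP; split.
    have := key (-1) _ (sqrr_sign _ 1) e'0.
    move=> /le_trans/(_ eC); lra.
  have := key 1 _ (expr1n _ _) e'0.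
  by rewrite mul1r => /le_trans; apply.
by apply/esym/eqP; rewrite -subr_eq0 -normr_eq0 D0.
Qed.

End compose.

(** * Factorial moments of the fractional process *)

Lemma sum_coef_widen (R : realType) (p : {poly R}) N (v : nat -> R) : (size p <= N)%N ->
  \sum_(i < size p) p`_i * v i = \sum_(i < N) p`_i * v i.
Proof.
move=> pN; rewrite (big_ord_widen _ (fun i => p`_i * v i) pN) big_mkcond.
apply: eq_bigr => i _; case: ltnP => // pi.
by rewrite nth_default// mul0r.
Qed.

(** The powers of [u] in the polynomial of the factorial moment are replaced by the
    moments of the time; the factor [n!] cancels and the term [n = 0] vanishes
    since [r > 0]. *)
Lemma skellam_poly_value (R : realType) k (lambda mu : 'I_k -> R) r alpha t (v : nat -> R) :
  (0 < r)%N ->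
  (forall n, (0 < n)%N -> v n = n`!%:R / Gamma (n%:R * alpha + 1) * t `^ (n%:R * alpha)) ->
  \sum_(i < size (skellam_poly lambda mu r)) (skellam_poly lambda mu r)`_i * v i =
  r`!%:R * \sum_(1 <= n < r.+1)
     t `^ (n%:R * alpha) / Gamma (n%:R * alpha + 1) *
     \sum_(m : {ffun 'I_n -> 'I_r.+1} |
             (\sum_(l < n) m l == r)%N && [forall l, (0 < m l)%N])
        \prod_(l < n)
          ((m l)`!%:R^-1 *
           \sum_(j < k)
             ((j.+1 ^_ (m l))%:R * lambda j
              + (-1) ^+ m l * (rising_factorial j.+1 (m l))%:R * mu j)).
Proof.
move=> r0 vE.
pose c n : R := r`!%:R / n`!%:R * (jump_series lambda mu r ^+ n)`_r.
have pE : skellam_poly lambda mu r = \poly_(n < r.+1) c n by rewrite poly_def.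
have cE n : (n <= r)%N -> (skellam_poly lambda mu r)`_n = c n.
  by move=> nr; rewrite pE coef_poly ltnS nr.
rewrite (@sum_coef_widen _ _ r.+1); last by rewrite pE size_poly.
rewrite -(big_mkord xpredT (fun n => (skellam_poly lambda mu r)`_n * v n)).
rewrite big_ltn// cE// /c expr0 coef1 [(r == 0)%N]gtn_eqF// mulr0 mul0r add0r mulr_sumr.
apply: eq_big_nat => n /andP[n0 nr].
rewrite cE// /c vE// -coef_jump_seriesX//.
have f0 : (n`!%:R : R) != 0 by rewrite pnatr_eq0 -lt0n fact_gt0.
have cancel (a f x y z : R) : f != 0 -> a / f * x * (f * y * z) = a * (z * y * x).
  by move=> fN0; field.
exact: cancel.
Qed.

Lemma GSP_right_continuous (R : realType) d (T : measurableType d) (P : probability T R)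
    k (lambda mu : 'I_k -> R) (S : process P) (V : T -> R) :
  (forall w, 0 <= V w) -> GSP lambda mu S ->
  {ae P, forall w, forall u : nat -> R, (forall n, V w < u n) ->
  u n @[n --> \oo] --> V w -> S (u n) w @[n --> \oo] --> S (V w) w}.
Proof.
move=> V0 [M1 [M2 [[c1 _] [c2 _] _ SE]]].
apply: filterS2 c1 c2 => w [_ _ _ r1] [_ _ _ r2] u Vu uV.
rewrite SE//.
have -> : (fun n => S (u n) w) = (fun n => M1 (u n) w - M2 (u n) w).
  by apply/funext => n; rewrite SE// (le_trans (V0 w))// ltW.
have /cvg_at_rightP q1 := r1 _ (V0 w); have /cvg_at_rightP q2 := r2 _ (V0 w).
by apply: cvgB; [apply: q1|apply: q2]; split.
Qed.

Theorem proposition3p3 (R : realType) (d : measure_display)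
    (T : measurableType d) (P : probability T R)
    (k : nat) (lambda mu : 'I_k -> R) (alpha : R) (X : process P)
    (hk : (1 <= k)%N)
    (hlambda : forall j, 0 < lambda j) (hmu : forall j, 0 < mu j)
    (halpha : 0 < alpha <= 1)
    (hX : GFSP alpha lambda mu X)
    (r : nat) (hr : (1 <= r)%N) (t : R) (ht : 0 <= t) :
  factorial_moment P (X t) r =
  (r`!%:R * \sum_(1 <= n < r.+1)
     t `^ (n%:R * alpha) / Gamma (n%:R * alpha + 1) *
     \sum_(m : {ffun 'I_n -> 'I_r.+1} |
             (\sum_(l < n) m l == r)%N && [forall l, (0 < m l)%N])
        \prod_(l < n)
          ((m l)`!%:R^-1 *
           \sum_(j < k)
             ((j.+1 ^_ (m l))%:R * lambda j
              + (-1) ^+ m l * (rising_factorial j.+1 (m l))%:R * mu j)))%:E.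
Proof.
rewrite /factorial_moment unlock.
have [S GS XS] := hX.
have mean n : poly_mean P S (falling_poly n) (skellam_poly lambda mu n).
  move=> u u0; rewrite horner_skellam_poly.
  apply: (eq_has_integral (f := fun w => falling (S u w) n)).
    by move=> w; rewrite horner_falling_poly.
  exact: GSP_factorial_moment.
case: XS => [[alpha1 XE]|[alpha01 [Y [invY indSY XE]]]].
  rewrite -(skellam_poly_value lambda mu hr (v := fun n => t ^+ n)); last first.
    move=> n n0; rewrite alpha1 mulr1 Gamma_nat divff ?mul1r ?powR_mulrn//.
  rewrite -horner_coef -(has_integralE (mean r t ht)).
  by apply: eq_integral => w _; rewrite horner_falling_poly XE.
have [D stD YE] := invY.
have Y0 w : 0 <= Y t w by rewrite YE//; exact: first_passage_ge0.
have alpha0 : 0 < alpha by case/andP: alpha01.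
pose v n := if n is 0%N then 1 else n`!%:R / Gamma (n%:R * alpha + 1) * t `^ (n%:R * alpha).
have Ymoment n : has_integral P setT (fun w => Y t w ^+ n) (v n).
  case: n => [|n]; first exact: has_integral1.
  exact: (inverse_stable_moment alpha0 stD YE).
rewrite -(skellam_poly_value lambda mu hr (v := v)); last by case.
have [q2 mean2] := poly_mean_falling_mul mean r r.
have := compose_moment ht Y0 indSY (GSP_right_continuous Y0 GS)
  (measurable_funPT (X t)) (fun w => XE t w ht) Ymoment (mean r) mean2.
move=> /has_integralE <-.
by apply: eq_integral => w _; rewrite horner_falling_poly.
Qed.
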